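(* Suppose that $$\varepsilon\ge D\sqrt{\frac{A\log N}{n}}$$ with a large enough numerical constant $D>0$. For all $J\subset\{1,\dots,N\}$, for all subspaces $L$ of $L_2(P)$ with $d:=\dim(L)$ and for all $A\ge1$, the following bounds hold with probability at least $1-N^{-A}$ and with a numerical constant $C>0$: $$\sum_{j\notin J}\hat\lambda^\varepsilon_j\le C\Bigl[\sum_{j\notin J}\lambda^\varepsilon_j+M^2\frac{d+A\log N}{n\varepsilon}+\max_{j\in J}\|P_{L^\perp}h_j\|_{L_2(P)}+\frac{U(L)\log N}{n\varepsilon}\Bigr],$$ $$\sum_{j\notin J}\lambda^\varepsilon_j\le C\Bigl[\sum_{j\notin J}\hat\lambda^\varepsilon_j+M^2\frac{d+A\log N}{n\varepsilon}+\max_{j\in J}\|P_{L^\perp}h_j\|_{L_2(P)}+\frac{U(L)\log N}{n\varepsilon}\Bigr]$$ and $$\|f_{\hat\lambda^\varepsilon}-f_{\lambda^\varepsilon}\|^2_{L_2(\mu)}+\varepsilon K(\hat\lambda^\varepsilon,\lambda^\varepsilon)\le C\Bigl[M^2\frac{d+A\log N}{n}\vee\Bigl(\sum_{j\notin J}\lambda^\varepsilon_j\Bigr)\sqrt{\frac{A\log N}{n}}\vee\max_{j\in J}\|P_{L^\perp}h_j\|_{L_2(P)}\sqrt{\frac{A\log N}{n}}\vee\frac{U(L)\log N}{n}\Bigr].$$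
   Context: Density estimation setting. $X_1,\dots,X_n$ are i.i.d. random variables in a measurable space $(S,\mathcal A)$ with common distribution $P$, and $P_n$ is their empirical distribution; $Pg=\mathbb E g(X_1)$, $P_ng=n^{-1}\sum_{i=1}^ng(X_i)$. $P$ has a density $f_*$ with respect to a $\sigma$-finite measure $\mu$ on $(S,\mathcal A)$, and $f_*$ is uniformly bounded by a constant $M$. The dictionary $h_1,\dots,h_N$ consists of probability densities with respect to $\mu$ that are uniformly bounded by $1$. $\Lambda=\{(\lambda_1,\dots,\lambda_N):\lambda_j\ge0,\ \sum_{j=1}^N\lambda_j=1\}$ and $f_\lambda=\sum_{j=1}^N\lambda_jh_j$. Estimators. For a regularization parameter $\varepsilon$ (with $0\log0=0$), $$\hat\lambda^\varepsilon:=\operatorname*{argmin}_{\lambda\in\Lambda}\Bigl[\|f_\lambda\|^2_{L_2(\mu)}-2P_nf_\lambda+\varepsilon\sum_{j=1}^N\lambda_j\log\lambda_j\Bigr],\qquad \lambda^\varepsilon:=\operatorname*{argmin}_{\lambda\in\Lambda}\Bigl[\|f_\lambda\|^2_{L_2(\mu)}-2Pf_\lambda+\varepsilon\sum_{j=1}^N\lambda_j\log\lambda_j\Bigr].$$ For $\lambda,\nu\in\Lambda$, $K(\lambda|\nu):=\sum_{j=1}^N\lambda_j\log(\lambda_j/\nu_j)$ and $K(\lambda,\nu):=K(\lambda|\nu)+K(\nu|\lambda)$. $a\vee b=\max(a,b)$. Subspaces. For a subspace $L\subset L_2(P)$, $U(L):=\sup_{f\in L,\ \|f\|_{L_2(P)}=1}\|f\|_\infty+1$;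 $L^\perp$ is its orthogonal complement in $L_2(P)$ and $P_{L^\perp}$ is the orthogonal projector onto $L^\perp$. Standing assumption: $N\ge(\log n)^\gamma$ for some $\gamma>0$.
   Formalization: The bound M on the density f_* is assumed to satisfy M ≥ 1 (for small M the stated bounds fail; a smaller bound may be replaced by 1), and the numerical constants D and C may depend on the γ of the standing assumption N ≥ (log n)^γ. *)

(* Defs.v *)
From HB Require Import structures.
From mathcomp Require Export all_boot all_order all_algebra.
From mathcomp Require Export all_classical all_reals all_analysis.
Export Order.TTheory GRing.Theory Num.Theory.
Export numFieldNormedType.Exports.

Set Implicit Arguments.
Unset Strict Implicit.
Unset Printing Implicit Defensive.

Local Open Scope classical_set_scope.
Local Open Scope ring_scope.

Definition mutually_independent (R : realType) (dO dS : measure_display)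
    (Omega : measurableType dO) (S : measurableType dS)
    (Pr : probability Omega R) (n : nat) (X : 'I_n -> {RV Pr >-> S}) : Prop :=
  forall (I : {set 'I_n}) (B : 'I_n -> set S),
    (forall i, measurable (B i)) ->
    Pr (\bigcap_(i in [set` I]) (X i @^-1` B i)) =
    (\prod_(i in I) Pr (X i @^-1` B i))%E.

Definition iid_sample (R : realType) (dO dS : measure_display)
    (Omega : measurableType dO) (S : measurableType dS)
    (Pr : probability Omega R) (P : probability S R)
    (n : nat) (X : 'I_n -> {RV Pr >-> S}) : Prop :=
  mutually_independent X /\
  forall i (B : set S), measurable B -> distribution Pr (X i) B = P B.

Definition empirical_mean (R : realType) (S : Type) (n : nat)
    (x : 'I_n -> S) (g : S -> R) : R :=
  n%:R^-1 * \sum_(i < n) g (x i).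

Definition has_density (R : realType) (dS : measure_display)
    (S : measurableType dS) (mu : {measure set S -> \bar R})
    (P : probability S R) (f : S -> R) : Prop :=
  [/\ measurable_fun [set: S] f, (forall x, 0 <= f x) &
      forall B, measurable B -> P B = (\int[mu]_(x in B) (f x)%:E)%E].

Definition probability_density (R : realType) (dS : measure_display)
    (S : measurableType dS) (mu : {measure set S -> \bar R})
    (f : S -> R) : Prop :=
  [/\ measurable_fun [set: S] f, (forall x, 0 <= f x) &
      (\int[mu]_x (f x)%:E)%E = 1%E].

Definition simplex (R : realType) (N : nat) : set 'rV[R]_N :=
  [set l | (forall j, 0 <= l 0 j) /\ \sum_(j < N) l 0 j = 1].

Definition mixture (R : realType) (S : Type) (N : nat)
    (h : 'I_N -> S -> R) (l : 'rV[R]_N) : S -> R :=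
  fun x => \sum_(j < N) l 0 j * h j x.

(* [Q] is the expectation functional: the empirical mean for the estimator,
   the integral against [P] for its population version.  The convention
   [0 log 0 = 0] holds since [ln 0 = 0]. *)
Definition penalized_risk (R : realType) (dS : measure_display)
    (S : measurableType dS) (mu : {measure set S -> \bar R}) (N : nat)
    (h : 'I_N -> S -> R) (eps : R) (Q : (S -> R) -> R) (l : 'rV[R]_N) : R :=
  fine ('N[mu]_2%:E[EFin \o mixture h l])%E ^+ 2
  - 2 * Q (mixture h l)
  + eps * \sum_(j < N) l 0 j * ln (l 0 j).

Definition is_argmin (R : realType) (T : Type) (A : set T) (F : T -> R)
    (a : T) : Prop :=
  A a /\ forall b, A b -> F a <= F b.

(* Extended-real valued: [K(l|v) = +oo] if [v_j = 0 < l_j] for some [j]. *)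
Definition KL (R : realType) (N : nat) (l v : 'rV[R]_N) : \bar R :=
  (\sum_(j < N)
     (if l 0%R j == 0%R then 0
      else if v 0%R j == 0%R then +oo
      else (l 0%R j * ln (l 0%R j / v 0%R j))%R%:E))%E.

Definition symKL (R : realType) (N : nat) (l v : 'rV[R]_N) : \bar R :=
  (KL l v + KL v l)%E.

Section L2.
Context (R : realType) (dS : measure_display) (S : measurableType dS).
Variable P : probability S R.

Definition L2 : set (S -> R) := [set f | f \in Lfun P 2%:E].

Definition L2dot (f g : S -> R) : R := \int[P]_x (f x * g x).

(* Elements of L_2(P) are classes of functions modulo P-a.e. equality; a
   subspace is represented by the set of all representatives of its elements. *)
Definition L2_subspace (L : set (S -> R)) : Prop :=
  [/\ L `<=` L2,
      L (cst 0),
      (forall (a : R) f g, L f -> L g -> L (fun x => a * f x + g x)) &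
      (forall f g, L f -> L2 g -> f = g %[ae P] -> L g)].

Definition L2_free (m : nat) (e : 'I_m -> S -> R) : Prop :=
  forall a : 'I_m -> R,
    (\forall x \ae P, \sum_(i < m) a i * e i x = 0) -> forall i, a i = 0.

(* Equal to [+oo] when [L] is infinite dimensional. *)
Definition L2_dim (L : set (S -> R)) : \bar R :=
  ereal_sup [set (m%:R : R)%:E | m in
    [set m : nat | exists e : 'I_m -> S -> R,
       (forall i, L (e i)) /\ L2_free e]].

(* [maxe 0] implements the convention [sup of the empty set = 0], needed for
   the null space; the sup norm of a class is the P-essential one. *)
Definition L2_U (L : set (S -> R)) : \bar R :=
  (maxe 0 (ereal_sup [set 'N[P]_+oo[EFin \o f] | f in
             [set f | L f /\ 'N[P]_2%:E[EFin \o f] = 1]]) + 1)%E.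

Definition L2_orth (L : set (S -> R)) : set (S -> R) :=
  [set g | L2 g /\ forall f, L f -> L2dot f g = 0].

Definition L2_is_proj (V : set (S -> R)) (f g : S -> R) : Prop :=
  V g /\ forall v, V v -> L2dot (f \- g) v = 0.

(* A representative of the orthogonal projection of [f] onto [V]; it exists and
   is unique up to P-a.e. equality when [V] is closed, in particular when [V]
   is an orthogonal complement. *)
Definition L2_proj (V : set (S -> R)) (f : S -> R) : S -> R :=
  xget (cst 0) [set g | L2_is_proj V f g].

Definition proj_orth_norm (L : set (S -> R)) (f : S -> R) : \bar R :=
  'N[P]_2%:E[EFin \o L2_proj (L2_orth L) f]%E.

End L2.

(* Main.v *)
Require Import Defs.
From mathcomp Require Import ring lra measurable_realfun ess_sup_inf.

(** A minimum point [l] of a penalized risk over the simplex has positive entries,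
    and comparing the first-order conditions at [lhat] and [l] gives, with
    [g = f_lhat - f_l],
      [2 ||g||_mu^2 + eps K(lhat, l) <= 2 (P_n - P) g].
    Everything follows from a bound of [(P_n - P) g] by
    [c P g^2] plus the remainder terms, uniformly over the simplex.

    The bound is proved on a finite sample space, to which one reduces by
    cutting [S] into cells on which the dictionary and the residuals
    [h_j - P_L h_j] are nearly constant.  There, the offset process
    [sup_g (P_n - P) g - c P g^2] concentrates around its mean: its exponential
    moments tensorize, because in each coordinate the variance of the supremum
    is paid for by a change of the offset.  The mean is estimated by
    symmetrization and contraction; given the sample, the offset absorbs the
    projection of the sign vector on the (at most [d]-dimensional) trace of [L],
    and the rest is a maximum of subgaussian variables.  The terms of the
    dictionary outside [J] are handled by peeling over dyadic values of
    [sum_(j notin J) |lhat_j - l_j|]; the condition [N >= (ln n)^gamma] pays for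
    the number of slices. *)

Set Implicit Arguments.
Unset Strict Implicit.
Unset Printing Implicit Defensive.

Local Open Scope classical_set_scope.
Local Open Scope ring_scope.

(** * Means on finite product spaces and concentration *)

(** A finite sample space settles two difficulties. Suprema over the simplex and the choice of the
    estimator come without measurability, whereas on a finite space every function has a mean; and
    an event that depends only on the cells of the sample points is measurable, however it is
    defined. The estimator depends on the sample, so one event must serve all [c]; the supremum over
    this infinite class becomes a maximum over a finite index set by selecting one violating [c] for
    each of the finitely many coded samples. The offset [c P g^2] has to be dominated by
    [||g||_mu^2], which forces [c] to be of order [1 / M]; the dimension is multiplied by the
    inverse of [c], hence the factor in [M] beside [d]. The residuals of the dictionary in [J] are
    bounded by [U(L)] and have norm at most [max ||P_(L^perp) h_j||], and a maximal inequality of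
    Bernstein type uses both. The mass of [lhat] outside [J] is reabsorbed: a coordinate with
    [lhat_j > 2 l_j] contributes at least [lhat_j / 4] to [K(lhat, l)], and the lower bound on [eps]
    makes the slope of the peeling small against [eps]. *)

Section FiniteMax.
Context (R : realType) (I : finType) (i0 : I).

Definition fmax (f : I -> R) : R := f [arg max_(i > i0) f i]%O.

Lemma fmax_ub f i : f i <= fmax f.
Proof. by rewrite /fmax; case: arg_maxP => //= j _; apply. Qed.

Lemma fmax_le f c : (forall i, f i <= c) -> fmax f <= c.
Proof. exact. Qed.

Lemma fmax_att f : exists i, fmax f = f i.
Proof. by eexists. Qed.

Lemma le_fmax f g : (forall i, f i <= g i) -> fmax f <= fmax g.
Proof. by move=> fg; apply: fmax_le => i; exact: le_trans (fg i) (fmax_ub g i). Qed.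

End FiniteMax.

Section Mean.
Context (R : realType).

(** Positivity, linearity and normalization on all real functions: one set of rules serves finite
    means, their iterations and the integral of functions of the cell. *)
Record is_mean (X : Type) (E : (X -> R) -> R) : Prop := IsMean {
  mean_le : forall F G, (forall x, F x <= G x) -> E F <= E G ;
  mean_lin : forall a F G, E (fun x => a * F x + G x) = a * E F + E G ;
  mean_cst : forall c, E (fun=> c) = c }.

Section Theory.
Context (X : Type) (E : (X -> R) -> R) (hE : is_mean E).

Lemma mean_ext F G : (forall x, F x = G x) -> E F = E G.
Proof. by move=> /funext ->. Qed.

Lemma meanD F G : E (fun x => F x + G x) = E F + E G.
Proof. by rewrite -[E F]mul1r -(mean_lin hE); apply: mean_ext => x; rewrite mul1r. Qed.

Lemma meanZ a F : E (fun x => a * F x) = a * E F.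
Proof.
have := mean_lin hE a F (fun=> 0); rewrite (mean_cst hE) addr0 => <-.
by apply: mean_ext => x; rewrite addr0.
Qed.

Lemma meanN F : E (fun x => - F x) = - E F.
Proof. by rewrite -mulN1r -meanZ; apply: mean_ext => x; rewrite mulN1r. Qed.

Lemma meanB F G : E (fun x => F x - G x) = E F - E G.
Proof. by rewrite meanD meanN. Qed.

Lemma meanZr a F : E (fun x => F x * a) = E F * a.
Proof. by rewrite mulrC -meanZ; apply: mean_ext => x; rewrite mulrC. Qed.

Lemma mean_sum (J : Type) (s : seq J) (P : pred J) (F : J -> X -> R) :
  E (fun x => \sum_(j <- s | P j) F j x) = \sum_(j <- s | P j) E (F j).
Proof.
elim: s => [|j s ih].
  rewrite big_nil -[RHS](mean_cst hE); by apply: mean_ext => x; rewrite big_nil.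
rewrite big_cons; case: ifP => Pj; rewrite -ih.
  by rewrite -meanD; apply: mean_ext => x; rewrite big_cons Pj.
by apply: mean_ext => x; rewrite big_cons Pj.
Qed.

Lemma mean_ge0 F : (forall x, 0 <= F x) -> 0 <= E F.
Proof. by move=> F0; rewrite -(mean_cst hE 0); apply: (mean_le hE). Qed.

Lemma mean_sqr F : E F ^+ 2 <= E (fun x => F x ^+ 2).
Proof.
have : 0 <= E (fun x => (F x - E F) ^+ 2) by apply: mean_ge0 => x; exact: sqr_ge0.
rewrite (@mean_ext _ (fun x => (F x ^+ 2 + ((- 2 * E F) * F x + E F ^+ 2)))); last first.
  by move=> x; ring.
rewrite meanD (mean_lin hE) (mean_cst hE); lra.
Qed.

End Theory.

Section FiniteMean.
Context (T : finType) (p : T -> R).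

Definition fprob := (forall t, 0 <= p t) /\ \sum_t p t = 1.

Definition fmean (F : T -> R) : R := \sum_t p t * F t.

(** Product expectation in iterated form, the head of the sequence being averaged last, so that
    tensorization is an induction on [n]. Only sequences of size [n] are evaluated. *)
Fixpoint imean (n : nat) (F : seq T -> R) : R :=
  if n is k.+1 then fmean (fun t => imean k (fun s => F (t :: s))) else F [::].

Hypothesis hp : fprob.

Lemma fmean_mean : is_mean fmean.
Proof.
split.
- move=> F G FG; apply: ler_sum => t _; apply: ler_wpM2l => //; exact: hp.1.
- move=> a F G; rewrite /fmean mulr_sumr -big_split; apply: eq_bigr => t _ /=; ring.
- by move=> c; rewrite /fmean -mulr_suml hp.2 mul1r.
Qed.

(** Fubini reduces to linearity, since one of the two means is a finite sum. *)
Lemma fmean_comm (X : Type) (E : (X -> R) -> R) (hE : is_mean E) (F : T -> X -> R) :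
  fmean (fun t => E (F t)) = E (fun x => fmean (fun t => F t x)).
Proof.
rewrite /fmean (mean_sum hE); apply: eq_bigr => t _; by rewrite (meanZ hE).
Qed.

Lemma imean_mean n : is_mean (imean n).
Proof.
elim: n => [|n ih]; first by split=> // F G /(_ [::]).
split => [F G FG|a F G|c] /=.
- apply: (mean_le fmean_mean) => t; exact: (mean_le ih).
- rewrite -(mean_lin fmean_mean); congr (fmean _); apply/funext => t.
  exact: (mean_lin ih).
- rewrite -[RHS](mean_cst fmean_mean); congr (fmean _); apply/funext => t.
  exact: (mean_cst ih).
Qed.

Lemma le_imean n F G : (forall s, size s = n -> F s <= G s) ->
  imean n F <= imean n G.
Proof.
elim: n F G => [|n ih] F G FG /=; first exact: FG.
apply: (mean_le fmean_mean) => t; apply: ih => s sn; apply: FG; by rewrite /= sn.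
Qed.

End FiniteMean.

(** From [expR (- y) >= 1 - y] follows [expR y <= 1 / (1 - y)], and [(1 - y) (1 + y + 2 y^2) = 1 +
    y^2 (1 - 2 y)]. The one-sided condition suits deviations that are controlled only from above. *)
Lemma expR_le_quad (y : R) : y <= 2^-1 -> expR y <= 1 + y + 2 * y ^+ 2.
Proof.
move=> y2; have y1 : 0 < 1 - y by lra.
have := expR_ge1Dx (- y); rewrite -[expR y]invrK -expRN => h.
rewrite -[leRHS]invrK lef_pV2 ?posrE ?invr_gt0 ?expR_gt0//; last by nra.
apply: le_trans h; rewrite -[_ ^-1]mul1r ler_pdivrMr; last by nra.
have : 0 <= y ^+ 2 * (1 - 2 * y) by rewrite mulr_ge0 ?sqr_ge0//; lra.
nra.
Qed.

(* A maximizer at [x] competes at [x'], so [m(x) - m(x')] is bounded by an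
   increment of [z]; hence the variance of [m] is at most
   [(E M - E m) / (2 theta)], where [m] and [M] are the suprema for [z] and [y]. *)
Lemma concentration_step (T : finType) (p : T -> R) (hp : fprob p)
  (X : Type) (Er : (X -> R) -> R) (hEr : is_mean Er)
  (I : finType) (i0 : I) (b : X -> I -> R) (z y : I -> T -> R) (theta : R) :
  0 < theta ->
  (forall i x, 2 * theta * fmean p (fun x' => (z i x - z i x') ^+ 2) <= y i x - z i x) ->
  (forall i x x', theta * (z i x - z i x') <= 2^-1) ->
  fmean p (fun x => expR (theta * Er (fun r => fmax i0 (fun i => b r i + z i x)))) <=
  expR (theta * fmean p (fun x => Er (fun r => fmax i0 (fun i => b r i + y i x)))).
Proof.
move=> th0 hyz hz.
set m := fun x => Er (fun r => fmax i0 (fun i => b r i + z i x)).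
set M := fun x => Er (fun r => fmax i0 (fun i => b r i + y i x)).
have hm := fmean_mean hp.
pose a x r := [arg max_(i > i0) (b r i + z i x)]%O.
have mB x x' : m x - m x' <= Er (fun r => z (a x r) x - z (a x r) x').
  rewrite /m -(meanB hEr); apply: (mean_le hEr) => r.
  have := fmax_ub i0 (fun i => b r i + z i x') (a x r).
  rewrite [fmax i0 (fun i => b r i + z i x)]/fmax -/(a x r); lra.
have mth x x' : theta * (m x - m x') <= 2^-1.
  apply: (@le_trans _ _ (theta * Er (fun r => z (a x r) x - z (a x r) x'))).
    by rewrite ler_pM2l.
  rewrite -(meanZ hEr) -(mean_cst hEr 2^-1); apply: (mean_le hEr) => r; exact: hz.
have MB x : 2 * theta * Er (fun r => fmean p (fun x' => (z (a x r) x - z (a x r) x') ^+ 2))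
    <= M x - m x.
  rewrite -(meanZ hEr) /M /m -(meanB hEr); apply: (mean_le hEr) => r.
  apply: le_trans (hyz (a x r) x) _.
  have := fmax_ub i0 (fun i => b r i + y i x) (a x r).
  rewrite [fmax i0 (fun i => b r i + z i x)]/fmax -/(a x r); lra.
(* A maximizer at [x] bounds only the positive part of [m x - m x']. This suffices: exchanging [x]
   and [x'] shows that the mean of [q] is the whole variance. *)
pose q x x' := Num.max 0 (m x - m x') ^+ 2.
have qE x x' : (m x - m x') ^+ 2 = q x x' + q x' x.
  rewrite /q; have [h|h] := leP (m x) (m x').
    rewrite max_l ?max_r; [|lra|lra]; ring.
  rewrite max_r ?max_l; [|lra|lra]; ring.
have qM x : 2 * theta * fmean p (q x) <= M x - m x.
  apply: le_trans (MB x); rewrite ler_pM2l; last by lra.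
  rewrite -(fmean_comm p hEr); apply: (mean_le hm) => x'; rewrite /q.
  apply: le_trans (mean_sqr hEr _).
  have := mB x x'; set e := Er _ => me.
  have [h|h] := leP 0 (m x - m x'); last by rewrite expr0n /= sqr_ge0.
  rewrite ler_sqr ?nnegrE //; lra.
set mu := fmean p m; set V := fmean p (fun x => (m x - mu) ^+ 2).
have VE : V = fmean p (fun x => fmean p (q x)).
  have e1 : fmean p (fun x => fmean p (fun x' => (m x - m x') ^+ 2)) = 2 * V.
    have e2 x : fmean p (fun x' => (m x - m x') ^+ 2) = (m x - mu) ^+ 2 + V.
      rewrite (@mean_ext _ _ _ (fun x' => (m x' - mu) ^+ 2 + ((- 2 * (m x - mu)) * m x'
         + ((m x - mu) ^+ 2 + 2 * (m x - mu) * mu)))); last by move=> x'; ring.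
      rewrite (meanD hm) (mean_lin hm) (mean_cst hm) -/mu -/V; ring.
    under mean_ext => x do rewrite e2.
    rewrite (meanD hm) (mean_cst hm) -/V; ring.
  move: e1; under mean_ext => x do under mean_ext => x' do rewrite qE.
  under mean_ext => x do rewrite (meanD hm).
  rewrite (meanD hm) -[X in _ + X](fmean_comm p hm) => e1.
  suff : 2 * fmean p (fun x => fmean p (q x)) = 2 * V by lra.
  rewrite -e1; ring.
have Vle : 2 * theta * V <= fmean p M - mu.
  rewrite VE -(meanZ hm) -(meanB hm); exact: (mean_le hm).
have mm x : theta * (m x - mu) <= 2^-1.
  rewrite /mu -{1}(mean_cst hm (m x)) -(meanB hm) -(meanZ hm) -(mean_cst hm 2^-1).
  exact: (mean_le hm).
(* Expansion around [mu]: the linear term has mean zero, and the quadratic one, [2 theta^2 V],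
   returns to the exponent by [1 + v <= expR v], where [Vle] pays for it. *)
apply: (@le_trans _ _ (fmean p (fun x => expR (theta * mu) *
   (1 + theta * (m x - mu) + 2 * (theta * (m x - mu)) ^+ 2)))).
  apply: (mean_le hm) => x.
  rewrite (_ : theta * m x = theta * mu + theta * (m x - mu)); last by ring.
  by rewrite expRD ler_pM2l ?expR_gt0// expR_le_quad.
rewrite (meanZ hm) (@mean_ext _ _ _ (fun x => (2 * theta ^+ 2) * (m x - mu) ^+ 2
   + (theta * m x + (1 - theta * mu)))); last by move=> x; ring.
rewrite (mean_lin hm) (mean_lin hm) (mean_cst hm) -/mu -/V.
apply: (@le_trans _ _ (expR (theta * mu) * expR (2 * theta ^+ 2 * V))).
  rewrite ler_pM2l ?expR_gt0//; apply: le_trans (expR_ge1Dx _); lra.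
rewrite -expRD ler_expR.
have : theta * (2 * theta * V) <= theta * (fmean p M - mu) by rewrite ler_pM2l.
nra.
Qed.

(** Tensorization: for a fixed head the induction hypothesis turns the tail into a mean with [y];
    then [concentration_step], with [Er] the mean over the tail, exchanges [z] for [y] at the
    head. *)
Lemma concentration (T : finType) (p : T -> R) (hp : fprob p)
  (I : finType) (i0 : I) (z y : I -> T -> R) (theta : R) :
  0 < theta ->
  (forall i x, 2 * theta * fmean p (fun x' => (z i x - z i x') ^+ 2) <= y i x - z i x) ->
  (forall i x x', theta * (z i x - z i x') <= 2^-1) ->
  forall n (a : I -> R),
  imean p n (fun s => expR (theta * fmax i0 (fun i => a i + \sum_(x <- s) z i x))) <=
  expR (theta * imean p n (fun s => fmax i0 (fun i => a i + \sum_(x <- s) y i x))).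
Proof.
move=> th0 hyz hz; elim=> [|n ih] a /=.
  rewrite le_eqVlt; apply/orP; left; apply/eqP; congr (expR (_ * fmax _ _)).
  by apply/funext => i; rewrite !big_nil.
apply: (@le_trans _ _ (fmean p (fun x => expR (theta *
   imean p n (fun s => fmax i0 (fun i => (a i + \sum_(x <- s) y i x) + z i x)))))).
  apply: (mean_le (fmean_mean hp)) => x.
  have shift s : (fun i => a i + \sum_(x' <- x :: s) z i x') =
      (fun i => a i + z i x + \sum_(x' <- s) z i x').
    by apply/funext => i; rewrite big_cons addrA.
  have swap s : (fun i => a i + \sum_(x' <- s) y i x' + z i x) =
      (fun i => a i + z i x + \sum_(x' <- s) y i x').
    by apply/funext => i; rewrite addrAC.
  under mean_ext => s do rewrite shift.
  under [in leRHS]mean_ext => s do rewrite swap.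
  exact: ih.
apply: le_trans (concentration_step hp (imean_mean hp n) i0 _ th0 hyz hz) _.
rewrite ler_expR ler_pM2l// le_eqVlt; apply/orP; left; apply/eqP.
apply: mean_ext => x; apply: mean_ext => s; congr fmax; apply/funext => i.
by rewrite big_cons; ring.
Qed.

(** One coordinate is exchanged at a time; the arbitrary shift [b] in the hypothesis stands for the
    contribution of all the others. *)
Lemma imean_replace (T T' : finType) (p : T -> R) (p' : T' -> R)
  (hp : fprob p) (hp' : fprob p') (I : finType) (i0 : I)
  (y : I -> T -> R) (y' : I -> T' -> R) :
  (forall b : I -> R, fmean p (fun x => fmax i0 (fun i => b i + y i x)) <=
     fmean p' (fun x => fmax i0 (fun i => b i + y' i x))) ->
  forall n (a : I -> R),
  imean p n (fun s => fmax i0 (fun i => a i + \sum_(x <- s) y i x)) <=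
  imean p' n (fun s => fmax i0 (fun i => a i + \sum_(x <- s) y' i x)).
Proof.
move=> h; elim=> [|n ih] a /=.
  rewrite le_eqVlt; apply/orP; left; apply/eqP; congr fmax.
  by apply/funext => i; rewrite !big_nil.
apply: (@le_trans _ _ (fmean p (fun x =>
   imean p' n (fun s => fmax i0 (fun i => (a i + \sum_(x <- s) y' i x) + y i x))))).
  apply: (mean_le (fmean_mean hp)) => x.
  have := ih (fun i => a i + y i x).
  congr (_ <= _); apply: mean_ext => s; congr fmax; apply/funext => i.
    by rewrite big_cons addrA.
  by rewrite addrAC.
rewrite !fmean_comm; [|exact: imean_mean|exact: imean_mean].
apply: (mean_le (imean_mean hp' n)) => s.
apply: le_trans (h _) _; rewrite le_eqVlt; apply/orP; left; apply/eqP.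
apply: mean_ext => x; congr fmax; apply/funext => i; rewrite big_cons; ring.
Qed.

End Mean.

(** * Random signs, symmetrization and contraction *)

Section Signs.
Context (R : realType).

Definition half (b : bool) : R := 2^-1.

Lemma half_fprob : fprob half.
Proof. by split=> [b|]; rewrite ?big_bool /half /=; lra. Qed.

Lemma fmean_half F : fmean half F = 2^-1 * (F true + F false).
Proof. by rewrite /fmean big_bool /half /= mulrDr. Qed.

Definition prodp (T T' : finType) (p : T -> R) (q : T' -> R) (x : T * T') :=
  p x.1 * q x.2.

Lemma fmean_prod (T T' : finType) (p : T -> R) (q : T' -> R) F :
  fmean (prodp p q) F = fmean p (fun x => fmean q (fun y => F (x, y))).
Proof.
rewrite /fmean (eq_bigr _ (fun x _ => mulr_sumr _ _ _ _)) pair_bigA.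
by apply: eq_bigr => -[x y] _; rewrite mulrA.
Qed.

Lemma prodp_fprob (T T' : finType) (p : T -> R) (q : T' -> R) :
  fprob p -> fprob q -> fprob (prodp p q).
Proof.
move=> hp hq; split=> [t|]; first by rewrite mulr_ge0 ?hp.1 ?hq.1.
have := fmean_prod p q (fun=> 1); rewrite (@mean_ext _ _ _ _ (fun=> 1)) => [|x].
  rewrite (mean_cst (fmean_mean hp)) /fmean => <-.
  by apply: eq_bigr => t _; rewrite mulr1.
by rewrite (mean_cst (fmean_mean hq)).
Qed.

Lemma imean_prod (T T' : finType) (p : T -> R) (q : T' -> R) n F :
  fprob p -> fprob q ->
  imean (prodp p q) n F = imean p n (fun s => imean q n (fun r => F (zip s r))).
Proof.
move=> hp hq; elim: n F => [|n ih] F //=.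
rewrite fmean_prod; apply: mean_ext => x.
under mean_ext => y do rewrite ih.
by rewrite (fmean_comm q (imean_mean hp n)).
Qed.

(* [g + 8 theta g^2] is 2-Lipschitz, so after symmetrization the offset
   process is dominated by the one with [2 g]. *)
Lemma symmetrize_contract (T : finType) (p : T -> R) (hp : fprob p)
  (I : finType) (i0 : I) (g : I -> T -> R) (theta : R) (b : I -> R) :
  0 < theta -> theta <= 16^-1 -> (forall i x, `|g i x| <= 1) ->
  fmean p (fun x => fmax i0 (fun i => b i + (g i x - fmean p (g i)
     + 4 * theta * g i x ^+ 2 - 12 * theta * fmean p (fun x => g i x ^+ 2)))) <=
  fmean (prodp p half) (fun xs => fmax i0 (fun i => b i +
     (4 * ((-1) ^+ xs.2 * g i xs.1) - 8 * theta * g i xs.1 ^+ 2))).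
Proof.
move=> th0 th1 g1; have hm := fmean_mean hp.
(* The coefficients [4 theta] and [12 theta] are those for which the integrand is the mean, over an
   independent copy [x'], of [ph i x - w i x - ph i x' - w i x']. *)
pose ph i x := g i x + 8 * theta * g i x ^+ 2; pose w i x := 4 * theta * g i x ^+ 2.
have phL i j x : `|ph i x - ph j x| <= 2 * `|g i x - g j x|.
  have -> : ph i x - ph j x = (g i x - g j x) * (1 + 8 * theta * (g i x + g j x)).
    rewrite /ph; ring.
  rewrite normrM mulrC ler_wpM2r// (le_trans (ler_normD _ _))// normr1.
  rewrite !normrM (ger0_norm (ltW th0)) ger0_norm //.
  have := le_trans (ler_normD (g i x) (g j x)) (lerD (g1 i x) (g1 j x)).
  have := normr_ge0 (g i x + g j x); nra.
rewrite fmean_prod.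
apply: (@le_trans _ _ (fmean p (fun x => fmean p (fun x' =>
   2^-1 * fmax i0 (fun i => b i + (2 * ph i x - 2 * w i x)) +
   2^-1 * fmax i0 (fun i => b i + (- 2 * ph i x' - 2 * w i x')))))).
  apply: (mean_le hm) => x; apply: fmax_le => i.
  apply: (@le_trans _ _ (fmean p (fun x' => 2^-1 * (b i + (2 * ph i x - 2 * w i x)) +
     2^-1 * (b i + (- 2 * ph i x' - 2 * w i x'))))).
    rewrite [leRHS](@mean_ext _ _ _ _ (fun x' => (-1) * g i x' + ((- 12 * theta) * (g i x' ^+ 2)
       + (b i + (g i x + 4 * theta * g i x ^+ 2))))) => [|x']; last by rewrite /ph /w; field.
    rewrite !(mean_lin hm) (mean_cst hm); lra.
  apply: (mean_le hm) => x'; apply: lerD; rewrite ler_pM2l ?invr_gt0//.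
    exact: (fmax_ub i0 (fun i => b i + (2 * ph i x - 2 * w i x))).
  exact: (fmax_ub i0 (fun i => b i + (- 2 * ph i x' - 2 * w i x'))).
under mean_ext => x do rewrite (meanD hm) (mean_cst hm).
rewrite (meanD hm) (mean_cst hm) -(meanD hm); apply: (mean_le hm) => x.
rewrite fmean_half /= expr0 expr1.
set G1 := fmax _ _; set G2 := fmax _ _; set G3 := fmax _ _; set G4 := fmax _ _.
suff : G1 + G2 <= G4 + G3 by lra.
(* Contraction at the two maximizers: [2 ph i x - 2 ph j x] is at most [4 |g i x - g j x|], and the
   index with the larger value of [g] takes the sign [+1], the other one [-1]. *)
have [i e1] := fmax_att i0 (fun i => b i + (2 * ph i x - 2 * w i x)).
have [j e2] := fmax_att i0 (fun i => b i + (- 2 * ph i x - 2 * w i x)).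
rewrite /G1 /G2 e1 e2.
have ub3 k : b k + (4 * (-1 * g k x) - 8 * theta * g k x ^+ 2) <= G3.
  exact: (fmax_ub i0 (fun k => b k + (4 * (-1 * g k x) - 8 * theta * g k x ^+ 2))).
have ub4 k : b k + (4 * (1 * g k x) - 8 * theta * g k x ^+ 2) <= G4.
  exact: (fmax_ub i0 (fun k => b k + (4 * (1 * g k x) - 8 * theta * g k x ^+ 2))).
have := phL i j x; rewrite ler_norml => /andP[_]; rewrite /w.
move: (ub3 i) (ub3 j) (ub4 i) (ub4 j).
have [h|h] := leP (g i x) (g j x); [rewrite ler0_norm|rewrite gtr0_norm]; lra.
Qed.

(** For [|x| <= 1/2] the linear terms of the two quadratic bounds cancel; beyond, [|x| <= 2 x^2]. *)
Lemma cosh_le (x : R) : 2^-1 * (expR x + expR (- x)) <= expR (2 * x ^+ 2).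
Proof.
have [h|h] := leP `|x| 2^-1.
  have := expR_ge1Dx (2 * x ^+ 2).
  move: h; rewrite ler_norml => /andP[h1 h2].
  have := expR_le_quad h2; have : - x <= 2^-1 by lra.
  move=> /expR_le_quad; rewrite sqrrN; lra.
apply: (@le_trans _ _ (expR `|x|)).
  have : expR x <= expR `|x| by rewrite ler_expR ler_norm.
  have : expR (- x) <= expR `|x| by rewrite ler_expR -normrN ler_norm.
  lra.
rewrite ler_expR -(real_normK (num_real x)); nra.
Qed.

(** Rademacher vector coded by a list of booleans, so that the iterated mean of [half] averages over
    it; the default [false] is not reached on lists of size [n]. *)
Definition signs n (r : seq bool) : 'rV[R]_n := \row_k (-1) ^+ nth false r k.

Lemma imean_signs_exp n (w : 'I_n -> R) (a : R) :
  imean half n (fun r => expR (a * \sum_k signs n r 0 k * w k)) <=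
  expR (2 * a ^+ 2 * \sum_k w k ^+ 2).
Proof.
elim: n w => [|n ih] w /=.
  by rewrite !big_ord0 !mulr0.
rewrite fmean_half [in leRHS]big_ord_recl [in leRHS]mulrDr [in leRHS]expRD.
have E b : imean half n (fun s => expR (a * \sum_k signs n.+1 (b :: s) 0 k * w k)) =
   expR ((-1) ^+ b * (a * w ord0)) * imean half n
     (fun s => expR (a * \sum_k signs n s 0 k * w (lift ord0 k))).
  rewrite -(meanZ (imean_mean half_fprob n)); apply: mean_ext => s.
  have -> : a * (\sum_k signs n.+1 (b :: s) 0 k * w k) =
      (-1) ^+ b * (a * w ord0) + a * (\sum_k signs n s 0 k * w (lift ord0 k)).
    rewrite big_ord_recl mulrDr; congr (_ + _); first by rewrite mxE /=; ring.
    by congr (_ * _); apply: eq_bigr => k _; rewrite !mxE.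
  exact: expRD.
rewrite (E true) (E false) => {E}.
have := ih (fun k => w (lift ord0 k)).
set Y := imean _ _ _ => Yle.
have Y0 : 0 <= Y by apply: (mean_ge0 (imean_mean half_fprob n)) => s; exact: expR_ge0.
clearbody Y; rewrite expr0 expr1 mul1r mulN1r.
apply: (@le_trans _ _ (2^-1 * (expR (a * w ord0) + expR (- (a * w ord0))) * Y)).
  rewrite le_eqVlt; apply/orP; left; apply/eqP; ring.
apply: ler_pM => //.
by apply: le_trans (cosh_le _) _; rewrite ler_expR exprMn mulrA.
Qed.

Lemma imean_signs_mean n (k : 'I_n) :
  imean half n (fun r => signs n r 0 k) = 0.
Proof.
elim: n k => [[]//|n ih] k /=; rewrite fmean_half.
case: (unliftP ord0 k) => [j ->|->].
  have E b : imean half n (fun s => signs n.+1 (b :: s) 0 (lift ord0 j)) = 0.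
    by rewrite -(ih j); apply: mean_ext => s; rewrite !mxE.
  by rewrite !E addr0 mulr0.
have E b : imean half n (fun s => signs n.+1 (b :: s) 0 ord0) = (-1) ^+ b.
  rewrite -[RHS](mean_cst (imean_mean half_fprob n)).
  by apply: mean_ext => s; rewrite !mxE.
by rewrite !E expr0 expr1 addNr mulr0.
Qed.

Lemma imean_signs_cov n (k l : 'I_n) :
  imean half n (fun r => signs n r 0 k * signs n r 0 l) = (k == l)%:R.
Proof.
elim: n k l => [[]//|n ih] k l /=; rewrite fmean_half.
have hm := imean_mean half_fprob n.
case: (unliftP ord0 k) => [i ->|->]; case: (unliftP ord0 l) => [j ->|->].
- have E b : imean half n (fun s => signs n.+1 (b :: s) 0 (lift ord0 i) *
     signs n.+1 (b :: s) 0 (lift ord0 j)) = (i == j)%:R.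
    by rewrite -ih; apply: mean_ext => s; rewrite !mxE.
  by rewrite !E (inj_eq lift_inj); lra.
- have E b : imean half n (fun s => signs n.+1 (b :: s) 0 (lift ord0 i) *
     signs n.+1 (b :: s) 0 ord0) = 0.
    transitivity (imean half n (fun s => signs n s 0 i) * (-1) ^+ b).
      by rewrite -(meanZr hm); apply: mean_ext => s; rewrite !mxE.
    by rewrite imean_signs_mean mul0r.
  by rewrite !E addr0 mulr0 [lift _ _ == _]eq_sym (negbTE (neq_lift _ _)).
- have E b : imean half n (fun s => signs n.+1 (b :: s) 0 ord0 *
     signs n.+1 (b :: s) 0 (lift ord0 j)) = 0.
    transitivity ((-1) ^+ b * imean half n (fun s => signs n s 0 j)).
      by rewrite -(meanZ hm); apply: mean_ext => s; rewrite !mxE.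
    by rewrite imean_signs_mean mulr0.
  by rewrite !E addr0 mulr0 (negbTE (neq_lift _ _)).
- have E b : imean half n (fun s => signs n.+1 (b :: s) 0 ord0 *
     signs n.+1 (b :: s) 0 ord0) = 1.
    rewrite -[RHS](mean_cst hm); apply: mean_ext => s; rewrite !mxE /=.
    by case: b; rewrite ?expr0 ?expr1 ?mulrNN mulr1.
  by rewrite !E eqxx /=; lra.
Qed.

(** The maximum is below the soft maximum, and the tangent inequality [1 + v <= expR v] at the level
    [c = ln #|I| + b] takes the place of Jensen's inequality for the logarithm. *)
Lemma mean_fmax (X : Type) (E : (X -> R) -> R) (hE : is_mean E)
  (I : finType) (i0 : I) (Y : I -> X -> R) (a b : R) : 0 < a ->
  (forall i, E (fun x => expR (a * Y i x)) <= expR b) ->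
  E (fun x => fmax i0 (fun i => Y i x)) <= (ln #|I|%:R + b) / a.
Proof.
move=> a0 h; rewrite ler_pdivlMr// mulrC -(meanZ hE).
have N0 : 0 < #|I|%:R :> R by rewrite ltr0n; apply/card_gt0P; exists i0.
set c := ln _ + b.
apply: (@le_trans _ _ (E (fun x => expR (- c) * (\sum_i expR (a * Y i x)) + (c - 1)))).
  apply: (mean_le hE) => x; have [i ->] := fmax_att i0 (fun i => Y i x).
  have e1 : 1 + (a * Y i x - c) <= expR (- c) * expR (a * Y i x).
    by rewrite -expRD (addrC (- c)) expR_ge1Dx.
  have : expR (- c) * expR (a * Y i x) <= expR (- c) * (\sum_i expR (a * Y i x)).
    rewrite ler_pM2l ?expR_gt0// (bigD1 i)//= lerDl sumr_ge0// => j _; exact: expR_ge0.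
  lra.
rewrite (mean_lin hE) (mean_cst hE) (mean_sum hE).
have : expR (- c) * (\sum_i E (fun x => expR (a * Y i x))) <= 1.
  apply: (@le_trans _ _ (expR (- c) * (\sum_(i : I) expR b))).
    by rewrite ler_pM2l ?expR_gt0// ler_sum.
  rewrite sumr_const -[expR b *+ _]mulr_natl expRN /c expRD lnK ?posrE//.
  by rewrite mulVf// mulf_neq0 ?gt_eqF ?expR_gt0.
lra.
Qed.

End Signs.

(** * Orthogonal projectors and the process conditional on the sample *)

Section Projector.
Context (R : realType) (n : nat).
Implicit Types u v w : 'rV[R]_n.

Definition dotv u v : R := (u *m v^T) 0 0.

Lemma dotvE u v : dotv u v = \sum_k u 0 k * v 0 k.
Proof. by rewrite /dotv mxE; apply: eq_bigr => k _; rewrite mxE. Qed.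

Lemma dotvC u v : dotv u v = dotv v u.
Proof. by rewrite !dotvE; apply: eq_bigr => k _; rewrite mulrC. Qed.

Lemma dotvBl u v w : dotv (u - v) w = dotv u w - dotv v w.
Proof. by rewrite /dotv mulmxBl !mxE. Qed.

Lemma dotvZl a u v : dotv (a *: u) v = a * dotv u v.
Proof. by rewrite /dotv -scalemxAl mxE. Qed.

Lemma dotvBr u v w : dotv u (v - w) = dotv u v - dotv u w.
Proof. by rewrite dotvC dotvBl !(dotvC u). Qed.

Lemma dotvZr a u v : dotv u (a *: v) = a * dotv u v.
Proof. by rewrite dotvC dotvZl dotvC. Qed.

Lemma dotv_ge0 u : 0 <= dotv u u.
Proof. by rewrite dotvE sumr_ge0// => k _; rewrite -expr2 sqr_ge0. Qed.

Lemma dotv_eq0 u : dotv u u = 0 -> u = 0.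
Proof.
rewrite dotvE => /eqP; rewrite psumr_eq0 => [/allP h|k _]; last first.
  by rewrite -expr2 sqr_ge0.
apply/rowP => k; rewrite mxE; apply/eqP.
by have := h k (mem_index_enum _); rewrite /= mulf_eq0 orbb.
Qed.

Lemma dotvM (A : 'M[R]_n) u v : dotv (u *m A) v = dotv u (v *m A^T).
Proof. by rewrite /dotv trmx_mul trmxK mulmxA. Qed.

Lemma dotv_mulmx u v : u *m v^T = (dotv u v)%:M.
Proof. by rewrite /dotv -mx11_scalar. Qed.

(** Gram-Schmidt by rows: the part [w] of a new row orthogonal to the earlier ones is either zero or
    adds a rank-one projector of trace 1. The trace is recorded because it is the mean squared norm
    of a projected sign vector. *)
Lemma projectorP m (E : 'M[R]_(m, n)) : exists Pi : 'M[R]_n,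
  [/\ Pi^T = Pi, Pi *m Pi = Pi, E *m Pi = E & (\tr Pi <= m%:R)].
Proof.
elim: m E => [|m ih] E.
  by exists 0; rewrite trmx0 mulmx0 mxtrace0 flatmx0; split=> //; exact/esym/flatmx0.
have [Pi [PT PP EP tP]] := ih (dsubmx (E : 'M[R]_(1 + m, n))).
pose e : 'rV[R]_n := usubmx (E : 'M[R]_(1 + m, n)).
pose w := e - e *m Pi.
have EE : E = col_mx e (dsubmx (E : 'M[R]_(1 + m, n))) by rewrite vsubmxK.
have wP : w *m Pi = 0 by rewrite /w mulmxBl -mulmxA PP subrr.
have Pw : Pi *m w^T = 0 by rewrite -[Pi]PT -trmx_mul wP trmx0.
have wE : w = e - e *m Pi by [].
clearbody w.
have [w0|wn0] := eqVneq w 0.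
  exists Pi; split=> //; last by rewrite (le_trans tP)// ler_nat.
  have eP : e *m Pi = e by apply/esym/eqP; rewrite -subr_eq0 -wE; apply/eqP.
  by rewrite EE (@mul_col_mx _ 1) EP eP.
have ww : dotv w w != 0 by apply: contra_neq wn0; exact: dotv_eq0.
exists (Pi + (dotv w w)^-1 *: (w^T *m w)); split.
- by rewrite linearD linearZ /= trmx_mul trmxK PT.
- have A1 : Pi *m (w^T *m w) = 0 by rewrite mulmxA Pw mul0mx.
  have A2 : (w^T *m w) *m Pi = 0 by rewrite -mulmxA wP mulmx0.
  have A3 : (w^T *m w) *m (w^T *m w) = dotv w w *: (w^T *m w).
    by rewrite mulmxA -[w^T *m w *m w^T]mulmxA dotv_mulmx mul_mx_scalar -scalemxAl.
  rewrite mulmxDl !mulmxDr PP -!scalemxAl -!scalemxAr A1 A2 A3 !scaler0 add0r addr0.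
  by rewrite !scalerA -mulrA mulVf// mulr1.
- rewrite EE (@mul_col_mx _ 1); apply: (f_equal2 (@col_mx R 1 m n)); rewrite mulmxDr.
    have ew : e *m w^T = (dotv w w)%:M.
      rewrite -dotv_mulmx {2}wE mulmxBl -[e *m Pi *m _]mulmxA Pw mulmx0 subr0 //.
    rewrite -scalemxAr mulmxA ew mul_scalar_mx scalerA mulVf// scale1r.
    by rewrite wE addrC subrK.
  rewrite EP -scalemxAr mulmxA.
  have -> : dsubmx (E : 'M[R]_(1 + m, n)) *m w^T = 0.
    by rewrite -EP -mulmxA Pw mulmx0.
  by rewrite mul0mx scaler0 addr0.
- rewrite mxtraceD mxtraceZ mxtrace_mulC dotv_mulmx mxtrace_scalar mulr1n mulVf//.
  by rewrite -(natr1 m) lerD2r.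
Qed.

End Projector.

(** * The sign process over fixed sample points *)

Section Conditional.
Context (R : realType).

(** The signs are uncorrelated with variance 1, so only the diagonal of [Pi] survives. *)
Lemma imean_signs_norm_proj n (Pi : 'M[R]_n) : Pi^T = Pi -> Pi *m Pi = Pi ->
  imean (half R) n (fun r => dotv (signs R n r *m Pi) (signs R n r *m Pi)) = \tr Pi.
Proof.
move=> PT PP; have hm := imean_mean (half_fprob R) n.
have E r : dotv (signs R n r *m Pi) (signs R n r *m Pi) =
    \sum_k \sum_l Pi l k * (signs R n r 0 l * signs R n r 0 k).
  rewrite dotvM PT -mulmxA PP dotvC dotvE; apply: eq_bigr => k _.
  by rewrite mxE mulr_suml; apply: eq_bigr => l _; rewrite mulrCA mulrA.
under mean_ext => r do rewrite E.
rewrite (mean_sum hm).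
under eq_bigr => k _ do rewrite (mean_sum hm).
under eq_bigr => k _ do under eq_bigr => l _ do rewrite (meanZ hm).
apply: eq_bigr => k _; rewrite (bigD1 k)//= imean_signs_cov eqxx mulr1 big1 ?addr0// => l lk.
by rewrite imean_signs_cov (negbTE lk) mulr0.
Qed.


(** Summing the exponentials at [a] and [- a] handles the absolute value, whence the [ln 2]; [a]
    stays free because the terms inside and outside [J] call for different scales. *)
Lemma imean_max_signs n (I : finType) (i0 : I) (r : I -> 'rV[R]_n) (a V : R) :
  0 < a -> (forall i, dotv (r i) (r i) <= V) ->
  imean (half R) n (fun s => fmax i0 (fun i => `|dotv (signs R n s) (r i)|)) <=
  (ln #|I|%:R + (ln 2 + 2 * a ^+ 2 * V)) / a.
Proof.
move=> a0 rV; have hm := imean_mean (half_fprob R) n.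
apply: (@mean_fmax _ _ _ hm _ _ (fun i s => `|dotv (signs R n s) (r i)|)) => // i.
have X b : imean (half R) n (fun s => expR (b * dotv (signs R n s) (r i))) <=
    expR (2 * b ^+ 2 * V).
  under mean_ext => s do rewrite dotvE.
  apply: le_trans (imean_signs_exp _ _) _; rewrite ler_expR.
  apply: ler_wpM2l; first by rewrite mulr_ge0 ?sqr_ge0.
  apply: le_trans (rV i); rewrite dotvE le_eqVlt; apply/orP; left; apply/eqP.
  by apply: eq_bigr => k _; rewrite expr2.
apply: (@le_trans _ _ (imean (half R) n (fun s => expR (a * dotv (signs R n s) (r i)) +
   expR (- a * dotv (signs R n s) (r i))))).
  apply: (mean_le hm) => s; have [h|h] := leP 0 (dotv (signs R n s) (r i)).
    by rewrite ger0_norm// lerDl expR_ge0.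
  by rewrite ltr0_norm// mulrN -mulNr lerDr expR_ge0.
rewrite (meanD hm) expRD lnK ?posrE//.
have := X a; have := X (- a); rewrite sqrrN; lra.
Qed.

(* For fixed sample points: [H] and [E] collect the values of the dictionary and
   of a spanning family of [L], and row [j] of [H - B *m E] those of the
   component of [h_j] orthogonal to [L]. *)
Lemma conditional_bound n m N (H : 'M[R]_(N.+1, n)) (E : 'M[R]_(m, n))
  (B : 'M[R]_(N.+1, m)) (J : {set 'I_N.+1}) (I : finType) (i0 : I)
  (c : I -> 'rV[R]_N.+1) (theta delta a1 a2 V : R) :
  0 < theta -> 0 <= delta -> 0 < a1 -> 0 < a2 ->
  (forall j k, `|H j k| <= 1) ->
  (forall i, \sum_j `|c i 0 j| <= 2) ->
  (forall i, \sum_(j in ~: J) `|c i 0 j| <= delta) ->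
  0 <= V ->
  (forall j, j \in J -> dotv (row j (H - B *m E)) (row j (H - B *m E)) <= V) ->
  imean (half R) n (fun s => fmax i0 (fun i =>
     4 * dotv (signs R n s) (c i *m H) - 8 * theta * dotv (c i *m H) (c i *m H))) <=
  m%:R / (2 * theta)
  + 4 * delta * ((ln N.+1%:R + (ln 2 + 2 * a1 ^+ 2 * n%:R)) / a1)
  + 8 * ((ln N.+1%:R + (ln 2 + 2 * a2 ^+ 2 * V)) / a2).
Proof.
move=> th0 d0 a10 a20 H1 c2 cd V0 QV.
have [Pi [PT PP EP tP]] := projectorP E.
have hm := imean_mean (half_fprob R) n.
pose r j := row j H - row j H *m Pi.
have perp v w : dotv (v - v *m Pi) (w *m Pi) = 0.
  by rewrite dotvC dotvM PT mulmxBl -mulmxA PP subrr /dotv trmx0 mulmx0 mxE.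
have pyth v : dotv v v = dotv (v *m Pi) (v *m Pi) + dotv (v - v *m Pi) (v - v *m Pi).
  have := perp v v; rewrite dotvBr !dotvBl (dotvC (v *m Pi) v); lra.
have rn j : dotv (r j) (r j) <= n%:R.
  apply: (@le_trans _ _ (dotv (row j H) (row j H))).
    rewrite [leRHS]pyth lerDr; exact: dotv_ge0.
  rewrite dotvE -[n in n%:R]card_ord -sum1_card natr_sum ler_sum// => k _.
  by rewrite !mxE -expr2 -(real_normK (num_real _)) expr_le1.
(* The rows of [B *m E] are fixed by [Pi], so [r j] is also the part of row [j] of [H - B *m E] off
   the range of [Pi], hence no longer than that row. *)
have rV j : j \in J -> dotv (r j) (r j) <= V.
  move=> jJ; apply: le_trans (QV j jJ).
  have -> : r j = row j (H - B *m E) - row j (H - B *m E) *m Pi.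
    rewrite /r linearB /= row_mul mulmxBl -mulmxA EP.
    by rewrite opprB addrA subrK.
  rewrite [leRHS]pyth lerDr; exact: dotv_ge0.
(* Padding with zero vectors keeps both maxima over the whole index set, also when [J] or its
   complement is empty. *)
pose r1 j := if j \in J then 0 else r j.
pose r2 j := if j \in J then r j else 0.
pose Y1 s := fmax ord0 (fun j => `|dotv (signs R n s) (r1 j)|).
pose Y2 s := fmax ord0 (fun j => `|dotv (signs R n s) (r2 j)|).
have dot00 : dotv (0 : 'rV[R]_n) 0 = 0 by rewrite /dotv mul0mx mxE.
have EY1 : imean (half R) n Y1 <= (ln N.+1%:R + (ln 2 + 2 * a1 ^+ 2 * n%:R)) / a1.
  rewrite -{1}(card_ord N.+1); apply: imean_max_signs => // j.
  by rewrite /r1; case: ifP => // _; rewrite dot00.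
have EY2 : imean (half R) n Y2 <= (ln N.+1%:R + (ln 2 + 2 * a2 ^+ 2 * V)) / a2.
  rewrite -{1}(card_ord N.+1); apply: imean_max_signs => // j.
  by rewrite /r2; case: ifP => [/rV//|_]; rewrite dot00.
apply: (@le_trans _ _ (imean (half R) n (fun s =>
   (2 * theta)^-1 * dotv (signs R n s *m Pi) (signs R n s *m Pi) +
   (4 * delta * Y1 s + 8 * Y2 s)))); last first.
  rewrite (mean_lin hm) (mean_lin hm) (meanZ hm) imean_signs_norm_proj//.
  rewrite -addrA lerD//; first by rewrite mulrC ler_wpM2r// invr_ge0; lra.
  by rewrite lerD// ler_wpM2l// mulr_ge0.
apply: (mean_le hm) => s; apply: fmax_le => i; set sg := signs R n s.
set v := c i *m H.
have vE : v - v *m Pi = \sum_j c i 0 j *: r j.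
  rewrite /v mulmx_sum_row mulmx_suml -sumrB; apply: eq_bigr => j _.
  by rewrite /r scalerBr scalemxAl.
have sgE : dotv sg v = dotv (sg *m Pi) (v *m Pi) + \sum_j c i 0 j * dotv sg (r j).
  rewrite dotvM PT -mulmxA PP.
  have -> : \sum_j c i 0 j * dotv sg (r j) = dotv sg (v - v *m Pi).
    rewrite vE [RHS]dotvC /dotv mulmx_suml summxE; apply: eq_bigr => j _.
    by rewrite -scalemxAl [RHS]mxE; congr (_ * _); exact: dotvC.
  by rewrite dotvBr addrC subrK.
have S1 : \sum_j c i 0 j * dotv sg (r j) <= delta * Y1 s + 2 * Y2 s.
  apply: (@le_trans _ _ (\sum_(j in J) `|c i 0 j| * Y2 s + \sum_(j in ~: J) `|c i 0 j| * Y1 s)).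
    rewrite (bigID (fun j => j \in J)) /=; apply: lerD.
      apply: ler_sum => j jJ; rewrite (le_trans (ler_norm _))// normrM ler_wpM2l//.
      have := fmax_ub ord0 (fun j => `|dotv sg (r2 j)|) j.
      by rewrite /r2 jJ.
    rewrite (eq_bigl (fun j => j \in ~: J)) => [|j]; last by rewrite inE.
    apply: ler_sum => j; rewrite inE => jJ; rewrite (le_trans (ler_norm _))// normrM ler_wpM2l//.
    have := fmax_ub ord0 (fun j => `|dotv sg (r1 j)|) j.
    by rewrite /r1 (negbTE jJ).
  have Y10 : 0 <= Y1 s by apply: le_trans (fmax_ub ord0 _ ord0); exact: normr_ge0.
  have Y20 : 0 <= Y2 s by apply: le_trans (fmax_ub ord0 _ ord0); exact: normr_ge0.
  rewrite -!mulr_suml addrC lerD// ler_wpM2r//.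
  apply: le_trans (c2 i); rewrite [leRHS](bigID (fun j => j \in J)) /= lerDl.
  by rewrite sumr_ge0.
have V1 : dotv (v *m Pi) (v *m Pi) <= dotv v v.
  by rewrite [leRHS]pyth lerDl dotv_ge0.
(* Completing the square: the sign vector meets [v *m Pi] only through its own projection, and the
   offset pays for the term in [v]. *)
have S2 : 4 * dotv (sg *m Pi) (v *m Pi) <= (2 * theta)^-1 * dotv (sg *m Pi) (sg *m Pi)
    + 8 * theta * dotv (v *m Pi) (v *m Pi).
  have := dotv_ge0 (sg *m Pi - (4 * theta) *: (v *m Pi)).
  rewrite dotvBr !dotvBl !dotvZr !dotvZl (dotvC (v *m Pi) (sg *m Pi)) => S.
  rewrite -(ler_pM2l (_ : 0 < 2 * theta)); last by lra.
  rewrite mulrDr mulVKf; [nra|by rewrite gt_eqF//; lra].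
have : 8 * theta * dotv (v *m Pi) (v *m Pi) <= 8 * theta * dotv v v.
  by rewrite ler_wpM2l//; lra.
rewrite sgE; lra.
Qed.

End Conditional.

(** * The offset process on a finite sample space *)

Section Core.
Context (R : realType).

(** Either the level is within a factor 2 of [D], or it is the last one: finitely many levels cannot
    locate an arbitrarily small [D], whence the additive resolution [2 / 2 ^+ K]. *)
Lemma dyadic_scale K (D : R) : 0 <= D <= 2 ->
  exists2 k, (k <= K)%N & D <= 2 / 2 ^+ k <= 2 * D + 2 / 2 ^+ K.
Proof.
move=> /andP[D0 D2].
suff [k [kK k1 k2]] : exists k, [/\ (k <= K)%N, D <= 2 / 2 ^+ k &
    2 / 2 ^+ k <= 2 * D \/ k = K].
  exists k => //; rewrite k1 /=.
  have : 0 < 2 / 2 ^+ K :> R by rewrite divr_gt0 ?exprn_gt0.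
  by case: k2 => [|->]; lra.
elim: K => [|K [k [kK k1 k2]]].
  by exists 0%N; split; [|rewrite expr0 divr1|right].
case: k2 => [k2|kE]; first by exists k; split; [exact: leqW| |left].
have eK : 2 / 2 ^+ K = 2 * (2 / 2 ^+ K.+1) :> R by rewrite exprS; field; rewrite expf_neq0.
have [hD|hD] := leP D (2 / 2 ^+ K.+1); first by exists K.+1; split; [| |right].
by exists k; split; [exact: leqW| |left; rewrite kE eK; lra].
Qed.

Lemma imean_expR_sum (T : finType) (p : T -> R) (hp : fprob p) (f : T -> R) n :
  imean p n (fun s => expR (\sum_(x <- s) f x)) = (fmean p (fun x => expR (f x))) ^+ n.
Proof.
elim: n => [|n ih] /=; first by rewrite big_nil expR0.
rewrite exprS -ih -(meanZr (fmean_mean hp)); apply: mean_ext => x.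
rewrite -(meanZ (imean_mean hp n)); apply: mean_ext => s.
by rewrite big_cons expRD.
Qed.

(** The scale [a = 1 / (2 U^2)] keeps the exponents [a q^2] below [1/2], where [expR y <= 1 + 2 y];
    thus the means are only doubled and the maximum costs a multiple of [U^2 ln #|I|]. *)
Lemma imean_max_squares (T : finType) (p : T -> R) (hp : fprob p) n
  (I : finType) (i0 : I) (q : I -> T -> R) (U rho2 : R) : 0 < U ->
  (forall i x, `|q i x| <= U) -> (forall i, fmean p (fun x => q i x ^+ 2) <= rho2) ->
  imean p n (fun s => fmax i0 (fun i => \sum_(x <- s) q i x ^+ 2)) <=
  2 * U ^+ 2 * ln #|I|%:R + 2 * n%:R * rho2.
Proof.
move=> U0 qU qr; have hm := fmean_mean hp.
set a := (2 * U ^+ 2)^-1; have a0 : 0 < a by rewrite invr_gt0 mulr_gt0 ?exprn_gt0.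
have -> : 2 * U ^+ 2 * ln #|I|%:R + 2 * n%:R * rho2 =
    (ln #|I|%:R + 2 * n%:R * (a * rho2)) / a.
  by rewrite /a; field; rewrite gt_eqF.
apply: (@mean_fmax _ _ _ (imean_mean hp n) _ _ (fun i s => \sum_(x <- s) q i x ^+ 2)) => // i.
under mean_ext => s do rewrite mulr_sumr.
rewrite imean_expR_sum// (_ : 2 * n%:R * (a * rho2) = n%:R * (2 * (a * rho2))); last by ring.
rewrite expRM_natl; apply: lerXn2r; rewrite ?nnegrE ?expR_ge0//.
  by apply: (mean_ge0 hm) => x; exact: expR_ge0.
apply: (@le_trans _ _ (fmean p (fun x => (2 * a) * q i x ^+ 2 + 1))).
  apply: (mean_le hm) => x.
  have y0 : 0 <= a * q i x ^+ 2 by rewrite mulr_ge0 ?sqr_ge0// ltW.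
  have y1 : a * q i x ^+ 2 <= 2^-1.
    rewrite /a mulrC ler_pdivrMr ?mulr_gt0 ?exprn_gt0//.
    rewrite -(real_normK (num_real _)); have := qU i x; have := normr_ge0 (q i x); nra.
  have := expR_le_quad y1; nra.
rewrite (mean_lin hm) (mean_cst hm); apply: le_trans (expR_ge1Dx _).
by rewrite addrC lerD2l -mulrA ler_pM2l// ler_pM2l.
Qed.

Variables (T : finType) (p : T -> R) (n m N : nat).
Variables (h : 'I_N.+1 -> T -> R) (e : 'I_m -> T -> R) (b : 'M[R]_(N.+1, m)).
Variables (J : {set 'I_N.+1}) (theta U rho2 a1 a2 : R).

Definition lcomb (c : 'rV[R]_N.+1) (x : T) : R := \sum_j c 0 j * h j x.

(** [16 theta] is [12 theta + 4 theta]: the first part is consumed by symmetrization and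
    contraction, the second by the change of offset in the concentration step. *)
Definition offset (c : 'rV[R]_N.+1) (x : T) : R :=
  lcomb c x - fmean p (lcomb c) - 16 * theta * fmean p (fun x => lcomb c x ^+ 2).

Definition offdict (c : 'rV[R]_N.+1) : R := \sum_(j in ~: J) `|c 0 j|.

Definition residual j x : R := h j x - \sum_k b j k * e k x.

(* [base_level + slope * delta] bounds the mean of the supremum of the offset
   process over [sum_(j notin J) |c_j| <= delta]; [a1] and [a2] are the free
   scales of the two maximal inequalities. *)
Definition base_level : R := m%:R / (2 * theta)
  + 8 * ((ln N.+1%:R + (ln 2 + 2 * a2 ^+ 2 *
      (2 * U ^+ 2 * ln N.+1%:R + 2 * n%:R * rho2))) / a2).

Definition slope : R := 4 * ((ln N.+1%:R + (ln 2 + 2 * a1 ^+ 2 * n%:R)) / a1).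

Hypotheses (hp : fprob p) (th0 : 0 < theta) (th1 : theta <= 16^-1) (U0 : 0 < U)
  (a10 : 0 < a1) (a20 : 0 < a2) (h1 : forall j x, `|h j x| <= 1)
  (resU : forall j x, j \in J -> `|residual j x| <= U) (rho20 : 0 <= rho2)
  (resr : forall j, j \in J -> fmean p (fun x => residual j x ^+ 2) <= rho2).

Section Class.
Variables (I : finType) (i0 : I) (c : I -> 'rV[R]_N.+1) (delta : R).
Hypotheses (d0 : 0 <= delta) (c2 : forall i, \sum_j `|c i 0 j| <= 2)
  (cd : forall i, offdict (c i) <= delta)
  (c1 : forall i x, `|lcomb (c i) x| <= 1).

(** For fixed sample points [conditional_bound] applies with the sample-dependent [V s]. Its bound
    is affine in [V s] with [a2] fixed, so only the mean of the largest sum of squared residuals is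
    needed. *)
Lemma imean_offset_symmetrized :
  imean (prodp p (half R)) n (fun s => fmax i0 (fun i => 0 + \sum_(xs <- s)
     (4 * ((-1) ^+ xs.2 * lcomb (c i) xs.1) - 8 * theta * lcomb (c i) xs.1 ^+ 2))) <=
  base_level + slope * delta.
Proof.
have hm := imean_mean hp n.
rewrite imean_prod//; last exact: half_fprob.
pose q j x := if j \in J then residual j x else 0.
pose V s := fmax ord0 (fun j => \sum_(x <- s) q j x ^+ 2).
have EV : imean p n V <= 2 * U ^+ 2 * ln N.+1%:R + 2 * n%:R * rho2.
  rewrite -[in ln N.+1%:R](card_ord N.+1); apply: imean_max_squares => // [j x|j].
    by rewrite /q; case: ifP => [jJ|_]; [exact: resU|rewrite normr0 ltW].
  rewrite /q; have [jJ|jJ] := boolP (j \in J); first exact: resr.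
  by under mean_ext => x do rewrite expr0n /=; rewrite (mean_cst (fmean_mean hp)).
apply: (@le_trans _ _ (imean p n (fun s => (8 * (2 * a2 ^+ 2 / a2)) * V s +
   (m%:R / (2 * theta) + slope * delta + 8 * ((ln N.+1%:R + ln 2) / a2))))); last first.
  rewrite (mean_lin hm) (mean_cst hm).
  have : 8 * (2 * a2 ^+ 2 / a2) * imean p n V <=
     8 * (2 * a2 ^+ 2 / a2) * (2 * U ^+ 2 * ln N.+1%:R + 2 * n%:R * rho2).
    by rewrite ler_pM2l// !(mulr_gt0, invr_gt0, exprn_gt0).
  rewrite /base_level; lra.
apply: le_imean => // s sn.
pose H : 'M[R]_(N.+1, n) := \matrix_(j, k) [seq h j x | x <- s]`_k.
pose E : 'M[R]_(m, n) := \matrix_(j, k) [seq e j x | x <- s]`_k.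
have sumE (f : T -> R) : \sum_(x <- s) f x = \sum_(k < n) [seq f x | x <- s]`_k.
  by rewrite -(big_map f predT id) (big_nth 0) size_map sn big_mkord.
have /= cb := @conditional_bound R n m N H E b J I i0 c theta delta a1 a2 (V s) th0 d0 a10 a20.
have V0 : 0 <= V s.
  apply: le_trans (fmax_ub ord0 _ ord0); apply: sumr_ge0 => x _; exact: sqr_ge0.
apply: (@le_trans _ _ (imean (half R) n (fun r => fmax i0 (fun i =>
  4 * dotv (signs R n r) (c i *m H) - 8 * theta * dotv (c i *m H) (c i *m H))))).
  apply: le_imean; first exact: half_fprob.
  move=> r rn; apply: le_fmax => i; rewrite add0r.
  have HE k : (c i *m H) 0 k = [seq lcomb (c i) x | x <- s]`_k.
    have ks : (k < size s)%N by rewrite sn.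
    case: s sn sumE @H @E cb V0 ks => [//|x0 s] sn sumE H E cb V0 ks.
    rewrite (nth_map x0)// mxE; apply: eq_bigr => j _.
    by rewrite mxE (nth_map x0).
  have zn : size (zip s r) = n by rewrite size_zip sn rn minnn.
  rewrite !dotvE !mulr_sumr -sumrB.
  case: n s sn rn zn sumE @H @E cb V0 HE => [|n'] s sn rn zn sumE H E cb V0 HE.
    by rewrite (size0nil zn) big_nil big_ord0.
  case: s sn zn sumE @H @E cb V0 HE => [//|x0 s] sn zn sumE H E cb V0 HE.
  rewrite (big_nth (x0, false)) zn big_mkord; apply: ler_sum => k _.
  rewrite nth_zip ?sn ?rn//= !HE mxE (nth_map x0) ?sn//; lra.
apply: le_trans (cb _ _ _ _ _) _ => //.
- move=> j k; rewrite mxE; have ks : (k < size s)%N by rewrite sn.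
  by case: s ks {sn sumE H E cb V0} => [//|x0 s] ks; rewrite (nth_map x0).
- move=> j jJ; rewrite dotvE.
  apply: le_trans (fmax_ub ord0 (fun j => \sum_(x <- s) q j x ^+ 2) j).
  rewrite sumE; apply: ler_sum => k _.
  have ks : (k < size s)%N by rewrite sn.
  case: s sn sumE @H @E cb V0 ks => [//|x0 s] sn sumE H E cb V0 ks.
  rewrite (nth_map x0)// /q jJ !mxE -expr2 le_eqVlt; apply/orP; left; apply/eqP.
  congr (_ ^+ 2); rewrite /residual !(nth_map x0)//; congr (_ - _).
  by apply: eq_bigr => l _; rewrite mxE (nth_map x0).
rewrite /slope; lra.
Qed.

Lemma imean_offset_exp :
  imean p n (fun s => expR (theta * fmax i0 (fun i => \sum_(x <- s) offset (c i) x))) <=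
  expR (theta * (base_level + slope * delta)).
Proof.
have hm := fmean_mean hp.
pose g i := lcomb (c i).
(* [y] exceeds the offset process by [4 theta] times [g^2] plus its mean, which dominates [2 theta]
   times the mean over [x'] of [(g x - g x')^2]. *)
pose y i x := g i x - fmean p (g i)
     + 4 * theta * g i x ^+ 2 - 12 * theta * fmean p (fun x => g i x ^+ 2).
have hz i x : 2 * theta * fmean p (fun x' => (offset (c i) x - offset (c i) x') ^+ 2)
    <= y i x - offset (c i) x.
  rewrite /offset /y -/(g i).
  set Eg := fmean p (g i); set Eg2 := fmean p (fun x => g i x ^+ 2).
  apply: (@le_trans _ _ (2 * theta * (fmean p (fun x' => 2 * g i x' ^+ 2 + 2 * g i x ^+ 2)))).
    rewrite ler_pM2l ?mulr_gt0//.
    apply: (mean_le hm) => x'; have := sqr_ge0 (g i x + g i x'); nra.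
  rewrite (mean_lin hm) (mean_cst hm) -/Eg2; lra.
have hb i x x' : theta * (offset (c i) x - offset (c i) x') <= 2^-1.
  rewrite /offset -/(g i).
  have := c1 i x; have := c1 i x'; rewrite -/(g i) !ler_norml => /andP[u1 u2] /andP[u3 u4].
  have := th0; have := th1; nra.
have := concentration hp i0 th0 hz hb n (fun=> 0).
under mean_ext => s do under eq_fun => i do rewrite add0r.
move/le_trans; apply; rewrite ler_expR ler_pM2l//.
apply: le_trans imean_offset_symmetrized.
apply: (imean_replace hp (prodp_fprob hp (half_fprob R)) (y := y)
  (y' := fun i xs => 4 * ((-1) ^+ xs.2 * g i xs.1) - 8 * theta * g i xs.1 ^+ 2)
  _ n (fun=> 0)) => d.
exact: symmetrize_contract.
Qed.

End Class.

(** The bounds 2 and 1 are those satisfied by a difference of two points of the simplex and by the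
    corresponding difference of mixtures with values in [0, 1]. *)
Definition oclass (delta : R) (c : 'rV[R]_N.+1) : Prop :=
  [/\ \sum_j `|c 0 j| <= 2, offdict c <= delta & forall x, `|lcomb c x| <= 1].

Lemma oclass0 delta : 0 <= delta -> oclass delta 0.
Proof.
move=> d0; split.
- by rewrite big1 // => j _; rewrite mxE normr0.
- by rewrite /offdict big1 // => j _; rewrite mxE normr0.
- by move=> x; rewrite /lcomb big1 ?normr0// => j _; rewrite mxE mul0r.
Qed.

(** Exponential Markov inequality for the maximum over a finite selection from the class; the zero
    vector fills in where no violation exists, so the selection stays in the class. *)
Lemma offset_slice delta t : 0 <= delta ->
  imean p n (fun s => (`[< exists2 c, oclass delta c &
     base_level + slope * delta + t < \sum_(x <- s) offset c x >])%:R) <=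
  expR (- (theta * t)).
Proof.
move=> d0; pose B := base_level + slope * delta.
pose bad s c := oclass delta c /\ B + t < \sum_(x <- s) offset c x.
pose c s := xget 0 [set c | bad s c].
have cC s : oclass delta (c s).
  by rewrite /c; case: xgetP => [c' _ []//|_]; exact: oclass0.
have [t0 _] : exists t0 : T, true.
  apply: contrapT => /forallNP T0; have := hp.2.
  rewrite big1 => [/esym/eqP|x _]; first by rewrite oner_eq0.
  by have := T0 x.
(* Choosing one violating [c] for each sample makes the class finite. *)
pose I := n.-tuple T.
have le1 : imean p n (fun s => expR (theta * fmax (nseq_tuple n t0)
    (fun i : I => \sum_(x <- s) offset (c (tval i)) x))) <= expR (theta * B).
  by apply: imean_offset_exp => // i; have [] := cC (tval i).
apply: (@le_trans _ _ (imean p n (fun s => expR (- (theta * (B + t))) *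
   expR (theta * fmax (nseq_tuple n t0)
    (fun i : I => \sum_(x <- s) offset (c (tval i)) x))))); last first.
  rewrite (meanZ (imean_mean hp n)).
  apply: (@le_trans _ _ (expR (- (theta * (B + t))) * expR (theta * B))).
    by rewrite ler_pM2l ?expR_gt0.
  rewrite -expRD ler_expR; lra.
apply: le_imean => // s sn; case: asboolP => [[c' c'C c'B]|_]; last first.
  by rewrite mulr_ge0 ?expR_ge0.
rewrite -expRD; apply: le_trans (expR_ge1Dx _); rewrite lerDl addrC -mulrBr.
rewrite mulr_ge0 ?(ltW th0)// subr_ge0.
have [_ cs] : bad s (c s) by rewrite /c; case: xgetP => [//|/(_ c')[]]; split.
apply: le_trans (ltW cs) _.
have sz : size s == n by rewrite sn.
exact: (fmax_ub _ (fun i : I => \sum_(x <- s) offset (c (tval i)) x) (Tuple sz)).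
Qed.

Lemma slope_ge0 : 0 <= slope.
Proof.
have l1 : 0 <= ln N.+1%:R :> R by rewrite ln_ge0// ler1n.
have l2 : 0 <= ln 2 :> R by rewrite ln_ge0// ler1n.
have l3 : 0 <= 2 * a1 ^+ 2 * n%:R by rewrite mulr_ge0// mulr_ge0// sqr_ge0.
by rewrite /slope mulr_ge0// divr_ge0 ?(ltW a10)// addr_ge0// addr_ge0.
Qed.

(** Union bound over the dyadic levels of [offdict]: the bound adapts to each [c], up to a factor 2
    and the resolution of the last level, at the price of the factor [K + 1]. *)
Lemma offset_peeling K t :
  imean p n (fun s => (`[< exists2 c, oclass 2 c &
     base_level + slope * (2 * offdict c + 2 / 2 ^+ K) + t <
     \sum_(x <- s) offset c x >])%:R) <= K.+1%:R * expR (- (theta * t)).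
Proof.
have hmn := imean_mean hp n.
pose d k : R := 2 / 2 ^+ k.
pose F k s : R := (`[< exists2 c, oclass (d k) c &
     base_level + slope * d k + t < \sum_(x <- s) offset c x >])%:R.
have slope0 := slope_ge0.
apply: (@le_trans _ _ (imean p n (fun s => \sum_(k < K.+1) F k s))); last first.
  rewrite (mean_sum hmn) -[K.+1 in leRHS]card_ord -sum1_card natr_sum mulr_suml.
  apply: ler_sum => k _; rewrite mul1r; apply: offset_slice.
  by rewrite /d divr_ge0 ?exprn_ge0.
apply: (mean_le hmn) => s; case: asboolP => [[c [c1 c2 c3] cB]|_]; last first.
  by apply: sumr_ge0 => k _; rewrite ler0n.
have [k kK /andP[k1 k2]] : exists2 k, (k <= K)%N &
    offdict c <= d k <= 2 * offdict c + d K.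
  by apply: dyadic_scale; rewrite c2 andbT /offdict sumr_ge0.
rewrite (bigD1 (Ordinal (kK : (k < K.+1)%N)))//= {1}/F asboolT ?lerDl ?sumr_ge0//.
exists c => //; apply: le_lt_trans cB; rewrite lerD2r lerD2l; exact: ler_wpM2l.
Qed.

End Core.

(** * Square integrable functions *)

Section SquareIntegrable.
Context (R : realType) (dS : measure_display) (S : measurableType dS).
Variable mu : {measure set S -> \bar R}.
Implicit Types f g k : S -> R.

Local Notation L2f f := (f \in Lfun mu 2%:E).

(* [L2dot] for an arbitrary measure. *)
Definition rdot f g : R := \int[mu]_x (f x * g x).

Lemma Lfun2_measurable f : L2f f -> measurable_fun setT f.
Proof. by rewrite inE => /andP[/[!inE]]. Qed.

Lemma Lnorm2_poweR f :
  ('N[mu]_2%:E[EFin \o f] `^ 2 = \int[mu]_x (f x ^+ 2)%:E)%E.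
Proof.
rewrite poweR_Lnorm ?pnatr_eq0//; apply: eq_integral => x _.
by rewrite /= powR_mulrn// real_normK ?num_real.
Qed.

Lemma Lfun2P f : measurable_fun setT f ->
  mu.-integrable setT (EFin \o (fun x => f x ^+ 2)) -> L2f f.
Proof.
move=> mf /integrableP[_ fi]; rewrite inE; apply/andP; split; rewrite inE//=.
rewrite /finite_norm (@lty_poweRy _ _ 2)//.
rewrite Lnorm2_poweR; apply: le_lt_trans fi.
by under [leRHS]eq_integral => x _ do rewrite /= ger0_norm ?sqr_ge0//.
Qed.

Lemma rdot_integrable f g : L2f f -> L2f g ->
  mu.-integrable setT (EFin \o (fun x => f x * g x)).
Proof. by move=> lf lg; apply/Lfun1_integrable; exact: Lfun2_mul_Lfun1. Qed.

(** Passage from the extended-real norm to a real bilinear form, in which all Hilbert space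
    computations are carried out. *)
Lemma Lnorm2E f : L2f f -> ('N[mu]_2%:E[EFin \o f] = (Num.sqrt (rdot f f))%:E)%E.
Proof.
move=> lf; have fi := rdot_integrable lf lf.
have I0 : 0 <= rdot f f by apply: Rintegral_ge0 => x _; rewrite -expr2 sqr_ge0.
have := Lnorm2_poweR f.
have -> : (\int[mu]_x (f x ^+ 2)%:E = (rdot f f)%:E)%E.
  by rewrite /rdot /Rintegral fineK//; exact: integrable_fin_num.
have := Lnorm_ge0 mu 2%:E (EFin \o f).
have : ('N[mu]_2%:E[EFin \o f] < +oo)%E.
  by move: lf; rewrite inE => /andP[_ /[!inE]].
case: ('N[mu]_2%:E[EFin \o f])%E => // r _; rewrite lee_fin => r0.
by rewrite poweR_EFin => -[]; rewrite powR_mulrn// => <-; rewrite sqrtr_sqr ger0_norm.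
Qed.

Lemma Lfun2_lin a f g : L2f f -> L2f g -> L2f (fun x => a * f x + g x).
Proof.
move=> lf lg; apply: Lfun2P.
  apply: measurable_funD; last exact: Lfun2_measurable.
  by apply: measurable_funM => //; exact: Lfun2_measurable.
have -> : EFin \o (fun x => (a * f x + g x) ^+ 2) =
    (fun x => ((a ^+ 2)%:E * (f x * f x)%:E + ((2 * a)%:E * (f x * g x)%:E + (g x * g x)%:E))%E).
  by apply/funext => x /=; rewrite -!EFinM -!EFinD; congr EFin; ring.
apply: integrableD => //; first by apply: integrableZl => //; exact: (rdot_integrable lf lf).
apply: integrableD => //; last exact: (rdot_integrable lg lg).
by apply: integrableZl => //; exact: (rdot_integrable lf lg).
Qed.

Lemma Lfun2_0 : L2f (fun=> 0).
Proof.
apply: Lfun2P => //; rewrite [X in mu.-integrable _ X](_ : _ = cst 0%E).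
  exact: integrable0.
by apply/funext => x /=; rewrite expr0n.
Qed.

Lemma rdotC f g : rdot f g = rdot g f.
Proof. by apply: eq_Rintegral => x _; rewrite mulrC. Qed.

Lemma rdot_linl a f g k : L2f f -> L2f g -> L2f k ->
  rdot (fun x => a * f x + g x) k = a * rdot f k + rdot g k.
Proof.
move=> lf lg lk; rewrite /rdot -RintegralZl//; last exact: rdot_integrable.
rewrite -RintegralD//; last 2 first.
  exact: (integrableZl measurableT a (rdot_integrable lf lk)).
  exact: rdot_integrable.
by apply: eq_Rintegral => x _; rewrite mulrDl mulrA.
Qed.

Lemma Lfun2_sum n (e : 'I_n -> S -> R) (a : 'I_n -> R) :
  (forall i, L2f (e i)) -> L2f (fun x => \sum_i a i * e i x).
Proof.
elim: n e a => [|n ih] e a le.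
  by under eq_fun => x do rewrite big_ord0; exact: Lfun2_0.
by under eq_fun => x do rewrite big_ord_recl; apply: Lfun2_lin => //; exact: ih.
Qed.

Lemma rdot0l k : rdot (fun=> 0) k = 0.
Proof.
rewrite /rdot; under eq_Rintegral => x _ do rewrite mul0r.
by rewrite Rintegral_cst// mul0r.
Qed.

Lemma rdot_suml n (e : 'I_n -> S -> R) (a : 'I_n -> R) k :
  (forall i, L2f (e i)) -> L2f k ->
  rdot (fun x => \sum_i a i * e i x) k = \sum_i a i * rdot (e i) k.
Proof.
elim: n e a => [|n ih] e a le lk.
  by rewrite big_ord0 -[RHS](rdot0l k); congr rdot; apply/funext => x; rewrite big_ord0.
rewrite big_ord_recl -ih//.
rewrite -rdot_linl//; last exact: Lfun2_sum.
by congr rdot; apply/funext => x; rewrite big_ord_recl.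
Qed.

Lemma rdot_ge0 f : 0 <= rdot f f.
Proof. by apply: Rintegral_ge0 => x _; rewrite -expr2 sqr_ge0. Qed.

Lemma rdot_eq0 f : L2f f -> rdot f f = 0 -> f = (fun=> 0) %[ae mu].
Proof.
move=> lf f0; have : (\int[mu]_x `| (f x * f x)%:E | = 0)%E.
  under eq_integral => x _ do rewrite gee0_abs ?lee_fin -?expr2 ?sqr_ge0//.
  have := integrable_fin_num measurableT (rdot_integrable lf lf).
  by move=> /fineK <- /=; congr EFin.
move/ae_eq_integral_abs => /(_ measurableT).
have mf := Lfun2_measurable lf.
have mff : measurable_fun setT (fun x => (f x * f x)%:E).
  by apply/measurable_EFinP; exact: measurable_funM.
move=> /(_ mff); apply: filterS => x /= /(_ I) [] /eqP.
by rewrite mulf_eq0 orbb => /eqP.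
Qed.

Lemma rdot_ae f f' g : L2f f -> L2f f' -> L2f g -> f = f' %[ae mu] ->
  rdot f g = rdot f' g.
Proof.
move=> lf lf' lg ff'; rewrite /rdot /Rintegral; congr fine; apply: ae_eq_integral => //.
- by apply/measurable_EFinP; apply: measurable_funM; exact: Lfun2_measurable.
- by apply/measurable_EFinP; apply: measurable_funM; exact: Lfun2_measurable.
by apply: filterS ff' => x /= /(_ I) ->.
Qed.

End SquareIntegrable.

(** * Finite-dimensional subspaces of [L_2(P)] *)

Section Subspace.
Context (R : realType) (dS : measure_display) (S : measurableType dS).
Variable P : probability S R.
Variable L : set (S -> R).
Hypothesis hL : L2_subspace P L.

Lemma subspace_Lfun2 f : L f -> f \in Lfun P 2%:E.
Proof. by case: hL => L2L _ _ _ /L2L. Qed.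

Lemma subspace_sum n (e : 'I_n -> S -> R) (a : 'I_n -> R) :
  (forall i, L (e i)) -> L (fun x => \sum_i a i * e i x).
Proof.
case: hL => _ L0 Ll _; elim: n e a => [|n ih] e a le.
  by under eq_fun => x do rewrite big_ord0.
by under eq_fun => x do rewrite big_ord_recl; apply: Ll => //; exact: ih.
Qed.

(** The finite dimension bounds the sizes of free families, and one of maximal size spans: adjoining
    [f] creates a relation, in which freeness makes the coefficient of [f] nonzero. *)
Lemma subspace_basis : (L2_dim P L < +oo)%E ->
  exists m (e : 'I_m -> S -> R), [/\ L2_dim P L = m%:R%:E,
    forall i, L (e i), L2_free P e &
    forall f, L f -> exists a : 'I_m -> R, f = (fun x => \sum_i a i * e i x) %[ae P]].
Proof.
move=> dfin.
pose A (m : nat) := exists e : 'I_m -> S -> R, (forall i, L (e i)) /\ L2_free P e.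
have A0 : A 0%N by exists (fun=> fun=> 0); split => [[]//|a _ []].
have Ale m : A m -> (m%:R%:E <= L2_dim P L)%E.
  by move=> Am; apply: ereal_sup_ubound; exists m.
have d0 : (0%:E <= L2_dim P L)%E by exact: (Ale 0%N).
have dE : L2_dim P L = (fine (L2_dim P L))%:E by rewrite fineK// ge0_fin_numE.
have Ab m : `[< A m >] -> (m <= Num.truncn (fine (L2_dim P L)))%N.
  by move=> /asboolP /Ale; rewrite dE lee_fin => mle; rewrite truncn_ge_nat// -lee_fin -dE.
have exA : exists m, `[< A m >] by exists 0%N; apply/asboolP.
have [m /asboolP Am mmax] := ex_maxnP exA Ab.
have [e [Le fe]] := Am; exists m, e; split=> //.
  apply/eqP; rewrite eq_le Ale// andbT; apply: ge_ereal_sup => _ [k Ak <-].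
  by rewrite lee_fin ler_nat mmax//; apply/asboolP.
move=> f Lf.
pose e' (i : 'I_m.+1) := if unlift ord0 i is Some j then e j else f.
have : ~ L2_free P e'.
  move=> fe'; have : A m.+1.
    by exists e'; split=> // i; rewrite /e'; case: (unlift ord0 i).
  by move=> /asboolP/mmax; rewrite ltnn.
move=> /existsNP[a /not_implyP[ae0 /existsNP[i ai]]].
have ae1 : \forall x \ae P, a ord0 * f x + \sum_j a (lift ord0 j) * e j x = 0.
  apply: filterS ae0 => x; rewrite big_ord_recl /e' unlift_none.
  by under eq_bigr => j _ do rewrite liftK.
have a00 : a ord0 != 0.
  apply/negP => /eqP a0; apply: ai; case: (unliftP ord0 i) => [j ->|->//].
  apply: (fe (fun j => a (lift ord0 j))); apply: filterS ae1 => x.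
  by rewrite a0 mul0r add0r.
exists (fun j => - (a ord0)^-1 * a (lift ord0 j)); apply: filterS ae1 => x ae1 _.
under eq_bigr => j _ do rewrite -mulrA.
rewrite -mulr_sumr; apply: (mulfI a00); rewrite mulrA mulrN mulfV// mulN1r.
by apply/eqP; rewrite -subr_eq0 opprK; apply/eqP.
Qed.

Section Basis.
Context (m : nat) (e : 'I_m -> S -> R).
Hypotheses (Le : forall i, L (e i)) (fe : L2_free P e)
  (spe : forall f, L f -> exists a : 'I_m -> R, f = (fun x => \sum_i a i * e i x) %[ae P]).

(** The coefficients solve the normal equations. The Gram matrix is invertible because a vector in
    its kernel gives a combination of norm zero, hence zero by freeness. *)
Lemma basis_projection h : h \in Lfun P 2%:E -> exists b : 'I_m -> R,
  L2_orth P L (fun x => h x - \sum_i b i * e i x).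
Proof.
move=> lh; pose G : 'M[R]_m := \matrix_(i, k) rdot P (e i) (e k).
have le i : e i \in Lfun P 2%:E by exact: subspace_Lfun2.
have lsum (a : 'I_m -> R) : (fun x => \sum_i a i * e i x) \in Lfun P 2%:E.
  exact: Lfun2_sum.
have Gu : G \in unitmx.
  rewrite -row_free_unit; apply: inj_row_free => v vG.
  have s0 : rdot P (fun x => \sum_i v 0 i * e i x) (fun x => \sum_i v 0 i * e i x) = 0.
    rewrite rdot_suml// big1// => i _; rewrite rdotC rdot_suml//.
    have := congr1 (fun M : 'rV_m => M 0 i) vG; rewrite !mxE => vGi.
    by rewrite (_ : \sum_j _ = 0) ?mulr0// -[RHS]vGi; apply: eq_bigr => j _; rewrite mxE.
  apply/rowP => i; rewrite mxE.
  apply: (fe (a := fun i => v 0 i)).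
  by apply: filterS (rdot_eq0 (lsum _) s0) => x /= /(_ I).
pose w : 'rV[R]_m := \row_k rdot P h (e k).
pose b := w *m invmx G; exists (fun i => b 0 i).
have bG k : \sum_i b 0 i * rdot P (e i) (e k) = rdot P h (e k).
  have : (b *m G) 0 k = w 0 k by rewrite /b -mulmxA mulVmx// mulmx1.
  rewrite [LHS]mxE [w 0 k]mxE => <-; apply: eq_bigr => i _; by rewrite [G i k]mxE.
pose q x := h x - \sum_i b 0 i * e i x.
have lq : q \in Lfun P 2%:E.
  have -> : q = (fun x => (-1) * (\sum_i b 0 i * e i x) + h x).
    by apply/funext => x; rewrite /q mulN1r addrC.
  exact: Lfun2_lin.
have qe k : rdot P q (e k) = 0.
  have -> : q = (fun x => (-1) * (\sum_i b 0 i * e i x) + h x).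
    by apply/funext => x; rewrite /q mulN1r addrC.
  by rewrite rdot_linl// rdot_suml// bG mulN1r addNr.
split=> // f Lf; have [a fa] := spe Lf.
change (rdot P f q = 0); rewrite (rdot_ae (f' := fun x => \sum_i a i * e i x)) //.
  by rewrite rdot_suml// big1// => i _; rewrite rdotC qe mulr0.
exact: subspace_Lfun2.
Qed.

(** [L2_proj] is a choice, here compared with the explicit residual [q]: the difference of two
    projections of [h] lies in the orthogonal complement and is orthogonal to itself. *)
Lemma proj_orth_normE h q : h \in Lfun P 2%:E -> L2_orth P L q ->
  L (fun x => h x - q x) ->
  proj_orth_norm P L h = (Num.sqrt (rdot P q q))%:E.
Proof.
move=> lh oq Lhq; rewrite /proj_orth_norm.
have qP : L2_is_proj P (L2_orth P L) h q.
  by split=> // v [_ ov]; apply: ov.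
have := @xgetPex _ (cst 0) [set g | L2_is_proj P (L2_orth P L) h g] (ex_intro _ q qP).
rewrite /L2_proj; set g := xget _ _ => -[og gP].
have [lq oqL] := oq; have [lg ogL] := og.
rewrite (Lnorm2E lg); congr (Num.sqrt _)%:E.
have lqN : (fun x => (-1) * q x + g x) \in Lfun P 2%:E by exact: Lfun2_lin.
have oqg : L2_orth P L (fun x => (-1) * q x + g x).
  split=> // f Lf; change (rdot P f (fun x => (-1) * q x + g x) = 0).
  have lf := subspace_Lfun2 Lf; rewrite rdotC rdot_linl// ![rdot _ _ f]rdotC.
  by rewrite (oqL f Lf : rdot P f q = 0) (ogL f Lf : rdot P f g = 0) mulr0 addr0.
have d0 : rdot P (fun x => (-1) * q x + g x) (fun x => (-1) * q x + g x) = 0.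
  have e1 : rdot P (fun x => (-1) * q x + h x) (fun x => (-1) * q x + g x) = 0.
    have := (qP.2 _ oqg); rewrite /L2dot /rdot => <-; apply: eq_Rintegral => x _ /=.
    congr (_ * _); ring.
  have e2 : rdot P (fun x => (-1) * g x + h x) (fun x => (-1) * q x + g x) = 0.
    have := (gP _ oqg); rewrite /L2dot /rdot => <-; apply: eq_Rintegral => x _ /=.
    congr (_ * _); ring.
  move: e1 e2; rewrite !rdot_linl//; lra.
have gq : g = q %[ae P].
  apply: filterS (rdot_eq0 lqN d0) => x /= /(_ I) e0 _; lra.
by rewrite (rdot_ae lg lq lg gq) rdotC (rdot_ae lg lq lq gq).
Qed.

End Basis.

(** Homogeneity extends the bound from the unit sphere to [L]; functions of norm zero vanish almost
    everywhere. The [- 1] undoes the [+ 1] in the definition of [U(L)]. *)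
Lemma subspace_sup_bound : (L2_U P L < +oo)%E -> exists2 u : R,
  1 <= u /\ L2_U P L = u%:E &
  forall f, L f -> \forall x \ae P, `|f x| <= (u - 1) * Num.sqrt (rdot P f f).
Proof.
rewrite /L2_U; set s := ereal_sup _; set v := maxe _ s => sfin.
have v0 : (0 <= v)%E by rewrite le_max lexx.
have sv : (s <= v)%E by rewrite le_max lexx orbT.
have vfin : (v < +oo)%E.
  by rewrite ltey; apply/eqP => vE; move: sfin; rewrite vE.
have mE : (v = (fine v)%:E)%E by rewrite fineK// ge0_fin_numE.
clearbody v.
set k := fine _ in mE.
have k0 : 0 <= k by rewrite -lee_fin -mE.
exists (k + 1); first by rewrite lerDr mE -EFinD.
move=> f Lf; rewrite addrK; have lf := subspace_Lfun2 Lf.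
have [f0|fn0] := eqVneq (rdot P f f) 0.
  apply: filterS (rdot_eq0 lf f0) => x /= /(_ I) ->.
  by rewrite f0 sqrtr0 mulr0 normr0.
have r0 : 0 < Num.sqrt (rdot P f f) by rewrite sqrtr_gt0 lt_def fn0 rdot_ge0.
set r := Num.sqrt _ in r0 *.
pose g x := r^-1 * f x + 0.
have Lg : L g by case: hL => _ L0 Ll _; exact: (Ll _ _ _ Lf L0).
have lg := subspace_Lfun2 Lg.
have g1 : 'N[P]_2%:E[EFin \o g]%E = 1%E.
  rewrite (Lnorm2E lg) (_ : rdot P g g = 1) ?sqrtr1//.
  have lf0 : (fun=> 0 : R) \in Lfun P 2%:E by exact: Lfun2_0.
  rewrite /g rdot_linl// rdot0l addr0 rdotC rdot_linl// rdot0l addr0.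
  rewrite mulrA -expr2 -(sqr_sqrtr (rdot_ge0 P f)) -/r -exprMn mulVf ?expr1n//.
  by rewrite gt_eqF.
have : ('N[P]_+oo[EFin \o g] <= s)%E by apply: ereal_sup_ubound; exists g.
have P0 : (0 < P setT)%E by rewrite probability_setT.
rewrite unlock ifT// => gs.
have : (ess_sup P (abse \o (EFin \o g)) <= k%:E)%E.
  by rewrite -mE; exact: le_trans gs sv.
move=> /ess_supP; apply: filterS => x /=; rewrite lee_fin /g addr0 normrM.
by rewrite gtr0_norm ?invr_gt0// mulrC ler_pdivrMr.
Qed.

(** The projection of [h j] has norm at most 1, hence sup norm at most [u - 1]; the [+ 1] in [U(L)]
    makes room for [h j] itself in the bound of the residual. *)
Lemma subspace_residuals N (h : 'I_N -> S -> R) :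
  (L2_dim P L < +oo)%E -> (L2_U P L < +oo)%E ->
  (forall j, measurable_fun setT (h j)) -> (forall j x, 0 <= h j x <= 1) ->
  exists m (e : 'I_m -> S -> R) (b : 'M[R]_(N, m)) (u : R),
    let q j x := h j x - \sum_k b j k * e k x in
    [/\ L2_dim P L = m%:R%:E, L2_U P L = u%:E /\ 1 <= u,
      forall j, measurable_fun setT (q j), forall j x, `|q j x| <= u &
      forall j, proj_orth_norm P L (h j) = (Num.sqrt (rdot P (q j) (q j)))%:E].
Proof.
move=> /subspace_basis[m [e [dE Le fe spe]]] /subspace_sup_bound[u [u1 uE] hu] mh h01.
have lh j : h j \in Lfun P 2%:E.
  apply: Lfun2P => //; apply: (@le_integrable _ _ _ P setT measurableT _ (cst 1%E)).
  - by apply/measurable_EFinP; exact: measurable_funX.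
  - move=> x _ /=; rewrite !ger0_norm ?sqr_ge0// lee_fin.
    by have /andP[? ?] := h01 j x; rewrite expr_le1.
  - exact: finite_measure_integrable_cst.
have le i : e i \in Lfun P 2%:E by exact: subspace_Lfun2.
have /choice[b bP] : forall j, exists b : 'I_m -> R,
  L2_orth P L (fun x => h j x - \sum_i b i * e i x).
  by move=> j; apply: basis_projection.
pose p j x := \sum_i b j i * e i x.
have Lp j : L (p j) by exact: subspace_sum.
have lp j : p j \in Lfun P 2%:E by exact: subspace_Lfun2.
have p1 j : rdot P (p j) (p j) <= 1.
  have [lq oq] := bP j; have := oq _ (Lp j).
  have qE : (fun x => h j x - p j x) = (fun x => (-1) * p j x + h j x).
    by apply/funext => x; rewrite mulN1r addrC.
  move=> pq; have {pq} : rdot P (fun x => (-1) * p j x + h j x) (p j) = 0.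
    by rewrite rdotC -qE.
  rewrite rdot_linl// => e1.
  have := rdot_ge0 P (fun x => (-1) * p j x + h j x).
  have lqj : (fun x => (-1) * p j x + h j x) \in Lfun P 2%:E by exact: Lfun2_lin.
  rewrite rdot_linl// ![rdot P _ (fun x => (-1) * p j x + h j x)]rdotC !rdot_linl//.
  rewrite (rdotC P (p j) (h j)) => e2.
  suff : rdot P (h j) (h j) <= 1 by lra.
  apply: (@le_trans _ _ (\int[P]_x (cst 1 x))).
    apply: le_Rintegral => //; first exact: rdot_integrable.
      exact: finite_measure_integrable_cst.
    by move=> x _ /=; rewrite -expr2; have /andP[? ?] := h01 j x; rewrite expr_le1.
  rewrite Rintegral_cst// mul1r [X in fine X](_ : _ = 1%E)//.
  exact: probability_setT.
have : \forall x \ae P, forall j, `|p j x| <= u - 1.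
  apply: filter_forall => j; apply: filterS (hu _ (Lp j)) => x hx.
  apply: le_trans hx _; rewrite ler_piMr ?subr_ge0//.
  by rewrite -sqrtr1 ler_sqrt.
move=> [Z [mZ Z0 hZ]].
(* Erasing the basis on the exceptional null set makes the bound on the residuals hold at every
   point, as the choice of representatives in the cells requires. *)
pose e' k x := e k x * \1_(~` Z) x.
have pE j x : \sum_k b j k * e' k x = p j x * \1_(~` Z) x.
  by rewrite mulr_suml; apply: eq_bigr => k _; rewrite mulrA.
exists m, e', (\matrix_(j, k) b j k), u => q.
have qE j x : q j x = h j x - p j x * \1_(~` Z) x.
  rewrite /q -pE; congr (_ - _); apply: eq_bigr => k _; by rewrite mxE.
have mq j : measurable_fun setT (q j).
  rewrite (_ : q j = h j \- (p j \* \1_(~` Z))); last by apply/funext => x; rewrite qE.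
  apply: measurable_funB => //; apply: measurable_funM; first exact: Lfun2_measurable (lp j).
  by apply: measurable_indic; exact: measurableC.
have qU j x : `|q j x| <= u.
  rewrite qE indicE; have /andP[h0 h1] := h01 j x.
  have [xZ|xZ] := boolP (x \in ~` Z).
    have /(_ j) : forall j, `|p j x| <= u - 1.
      by apply: contrapT => npx; move: xZ; rewrite inE => /(_ (hZ x npx)).
    rewrite mulr1 !ler_norml => /andP[]; lra.
  by rewrite mulr0 subr0 ger0_norm// (le_trans h1).
split=> // j; have [lq oq] := bP j.
  pose q0 x := h j x - p j x.
  have qq0 : q0 = q j %[ae P].
    exists Z; split=> // x /= /not_implyP[_ nq]; apply: contrapT => nZ; apply: nq.
    by rewrite qE /q0 indicE mem_set// mulr1.
  have lqj : q j \in Lfun P 2%:E.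
    apply: Lfun2P => //; apply: (@le_integrable _ _ _ P setT measurableT _ (cst (u ^+ 2)%:E)).
    + by apply/measurable_EFinP; exact: measurable_funX.
    + move=> x _ /=; rewrite lee_fin ger0_norm ?sqr_ge0// ger0_norm ?sqr_ge0//.
      by rewrite -(real_normK (num_real (q j x))) ler_sqr ?nnegrE ?qU// (le_trans _ u1).
    + exact: finite_measure_integrable_cst.
  rewrite (@proj_orth_normE (h j) q0) => //.
    by rewrite (rdot_ae lq lqj lq qq0) rdotC (rdot_ae lq lqj lqj qq0).
  rewrite (_ : (fun x => h j x - q0 x) = p j)//.
  by apply/funext => x; rewrite /q0 opprB addrC subrK.
Qed.

End Subspace.

(** * Reduction to a finite sample space *)

Section Cells.
Context (R : realType) (dS : measure_display) (S : measurableType dS).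

Lemma cells k (f : 'I_k -> S -> R) (U eta : R) : 0 < eta ->
  (forall j, measurable_fun setT (f j)) -> (forall j x, `|f j x| <= U) ->
  exists (T : finType) (kappa : S -> T) (rep : T -> S),
    (forall t, measurable (kappa @^-1` [set t])) /\
    forall j x, `|f j x - f j (rep (kappa x))| <= eta.
Proof.
move=> eta0 mf fU.
have f0 j x : 0 <= (f j x + U) / eta.
  rewrite divr_ge0 ?(ltW eta0)//; have := fU j x; rewrite ler_norml; lra.
pose code j x := Num.truncn ((f j x + U) / eta).
pose K := Num.truncn (2 * U / eta).
have codeK j x : (code j x < K.+1)%N.
  rewrite ltnS; apply: le_truncn; rewrite ler_pM2r ?invr_gt0//.
  have := fU j x; rewrite ler_norml; lra.
pose T := {ffun 'I_k -> 'I_K.+1}.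
pose kappa x : T := [ffun j => inord (code j x)].
(* Empty cells receive an arbitrary point; pointwise bounds valid on all of [S] hold there too. *)
pose rep (t : T) := xget point [set x | kappa x = t].
exists T, kappa, rep; split=> [t|j x].
  have -> : kappa @^-1` [set t] = \bigcap_(j in [set: 'I_k])
     (f j @^-1` `[eta * (t j)%:R - U, eta * (t j).+1%:R - U[).
    apply/seteqP; split=> x /=.
      move=> <- j _ /=; rewrite in_itv /= ffunE inordK//.
      have := truncn_itv (f0 j x); rewrite -/(code j x) ler_pdivlMr// ltr_pdivrMr//.
      rewrite ![eta * _]mulrC; lra.
    move=> xt; apply/ffunP => j; rewrite ffunE; apply: val_inj; rewrite /= inordK//.
    have := xt j I; rewrite /= in_itv /= => /andP[h1 h2].
    apply: truncn_def; rewrite ler_pdivlMr// ltr_pdivrMr//.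
    rewrite ![_ * eta]mulrC; lra.
  apply: fin_bigcap_measurable => // j _; rewrite -[X in measurable X]setTI.
  exact: mf.
have : kappa (rep (kappa x)) = kappa x.
  exact: (@xgetPex _ point [set y | kappa y = kappa x] (ex_intro _ x erefl)).
set y := rep _ => /(congr1 (fun t : T => val (t j))).
rewrite /= !ffunE !inordK// => cE.
have := truncn_itv (f0 j x); have := truncn_itv (f0 j y).
rewrite -/(code j x) -/(code j y) cE !ler_pdivlMr// !ltr_pdivrMr//.
rewrite -natr1 mulrDl mul1r ler_norml; lra.
Qed.

End Cells.

(** * The image of [P] on the finite set of cells *)

Section Transfer.
Context (R : realType) (dS : measure_display) (S : measurableType dS).
Variable P : probability S R.

Lemma bounded_integrable (f : S -> R) c : measurable_fun setT f ->
  (forall x, `|f x| <= c) -> P.-integrable setT (EFin \o f).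
Proof.
move=> mf fc; apply: (@le_integrable _ _ _ P setT measurableT _ (cst c%:E)).
- exact/measurable_EFinP.
- by move=> x _ /=; rewrite lee_fin (le_trans (fc x))// ler_norm.
- exact: finite_measure_integrable_cst.
Qed.

Context (T : finType) (kappa : S -> T).
Hypothesis mk : forall t, measurable (kappa @^-1` [set t]).

Definition cellp (t : T) : R := fine (P (kappa @^-1` [set t])).

Lemma measurable_cells (B : set T) : measurable (kappa @^-1` B).
Proof.
have -> : kappa @^-1` B = \bigcup_(t in B) kappa @^-1` [set t].
  by apply/seteqP; split=> x /=; [move=> Bx; exists (kappa x)|move=> [t Bt /= ->]].
by apply: fin_bigcup_measurable => // t _; exact: mk.
Qed.

Lemma measurable_fun_cells (g : T -> R) : measurable_fun setT (g \o kappa).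
Proof.
by move=> _ B mB; rewrite setTI comp_preimage; exact: measurable_cells.
Qed.

Lemma cells_integrable (g : T -> R) : P.-integrable setT (EFin \o (g \o kappa)).
Proof.
apply: (@bounded_integrable _ (\sum_t `|g t|)); first exact: measurable_fun_cells.
by move=> x /=; rewrite (bigD1 (kappa x))//= lerDl sumr_ge0.
Qed.

Lemma cells_mean : is_mean (fun g : T -> R => \int[P]_x g (kappa x)).
Proof.
split=> [F G FG|a F G|c].
- by apply: le_Rintegral => //; exact: cells_integrable.
- rewrite -RintegralZl//; last exact: cells_integrable.
  rewrite -RintegralD//; last exact: cells_integrable.
  exact: (integrableZl measurableT a (cells_integrable F)).
- rewrite Rintegral_cst// [X in fine X](_ : _ = 1%E) ?mulr1//.
  exact: probability_setT.
Qed.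

Lemma fmean_cellp (g : T -> R) : fmean cellp g = \int[P]_x g (kappa x).
Proof.
have -> : \int[P]_x g (kappa x) = \int[P]_x (\sum_t g t * (t == kappa x)%:R).
  apply: eq_Rintegral => x _; rewrite (bigD1 (kappa x))//= eqxx mulr1 big1 ?addr0//.
  by move=> t /negbTE ->; rewrite mulr0.
rewrite (mean_sum cells_mean _ _ (fun t y => g t * (t == y)%:R)).
apply: eq_bigr => t _; rewrite (meanZ cells_mean _ (fun y => (t == y)%:R)) mulrC.
congr (_ * _); rewrite /cellp -[LHS]mul1r -(Rintegral_cst P (mk t)).
rewrite Rintegral_mkcond; apply: eq_Rintegral => x _; rewrite patchE.
have [->|xt] := eqVneq t (kappa x); first by rewrite mem_set.
by rewrite memNset//= => tE; rewrite tE eqxx in xt.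
Qed.

Lemma cellp_fprob : fprob cellp.
Proof.
split=> [t|]; first exact: fine_ge0.
have := fmean_cellp (fun=> 1); rewrite (mean_cst cells_mean) /fmean => <-.
by apply: eq_bigr => t _; rewrite mulr1.
Qed.

End Transfer.

(** * The law of the coded sample *)

Section Sample.
Context (R : realType).

Lemma imean_tuple (T : finType) (p : T -> R) n (F : seq T -> R) :
  imean p n F = \sum_(x : n.-tuple T) (\prod_(i < n) p (tnth x i)) * F x.
Proof.
elim: n F => [|n ih] F /=.
  rewrite (big_pred1 [tuple]) ?big_ord0 ?mul1r// => x.
  by rewrite (tuple0 x); apply/esym/eqP.
rewrite /fmean (eq_bigr (fun t => \sum_(x : n.-tuple T) p t * ((\prod_(i < n) p (tnth x i)) * F (t :: x)))); last by move=> t _; rewrite ih mulr_sumr.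
rewrite pair_bigA /= (reindex (fun q : T * n.-tuple T => [tuple of q.1 :: q.2])) /=.
  apply: eq_bigr => -[t x] _ /=; rewrite mulrA big_ord_recl; congr (_ * _ * _).
  by apply: eq_bigr => i _; rewrite tnthS.
exists (fun x : n.+1.-tuple T => (thead x, [tuple of behead x])) => [[t x] _|x _] /=.
  by congr (_, _); apply: val_inj.
by rewrite -tuple_eta.
Qed.

Context (dS dO : measure_display) (S : measurableType dS) (Omega : measurableType dO).
Variables (Pr : probability Omega R) (P : probability S R).
Variables (n : nat) (X : 'I_n -> {RV Pr >-> S}).
Hypothesis iidX : iid_sample P X.
Context (T : finType) (kappa : S -> T).
Hypothesis mk : forall t, measurable (kappa @^-1` [set t]).

Definition coded w : n.-tuple T := [tuple kappa (X i w) | i < n].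

(** The event is a finite disjoint union of the sets [B x] where the code is [x]; each is
    measurable, and independence gives its probability as a product. *)
Lemma sample_event (A : pred (seq T)) :
  measurable [set w | A (coded w)] /\
  Pr [set w | A (coded w)] = (imean (cellp P kappa) n (fun s => (A s)%:R))%:E.
Proof.
pose B (x : n.-tuple T) := \bigcap_(i in [set` [set: 'I_n]%SET])
  (X i @^-1` (kappa @^-1` [set tnth x i])).
have BE x : B x = [set w | coded w = x].
  apply/seteqP; split=> w /=.
    by move=> Bw; apply: eq_from_tnth => i; rewrite tnth_mktuple; apply: Bw; rewrite /= inE.
  by move=> <- i _ /=; rewrite tnth_mktuple.
have mB x : measurable (B x).
  apply: fin_bigcap_measurable => // i _.
  by rewrite -[X in measurable X]setTI; apply: measurable_funPT.
have PB x : Pr (B x) = (\prod_(i < n) cellp P kappa (tnth x i))%:E.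
  have [ind idd] := iidX.
  rewrite /B (ind [set: 'I_n]%SET (fun i => kappa @^-1` [set tnth x i]))//.
  rewrite -prodEFin; apply: eq_big => [i|i _]; first by rewrite inE.
  rewrite /cellp fineK; last exact: fin_num_measure.
  by rewrite -(idd i).
have AE : [set w | A (coded w)] = \bigcup_(x in [set` [pred x : n.-tuple T | A x]]) B x.
  apply/seteqP; split=> w /=.
    by move=> Aw; exists (coded w) => //; rewrite BE.
  by move=> [x Ax]; rewrite BE => wx; move: Ax; rewrite -wx.
split.
  by rewrite AE; apply: fin_bigcup_measurable => // x _; exact: mB.
rewrite AE measure_fin_bigcup//; last first.
  by move=> x y _ _ [w []]; rewrite !BE /= => <- <-.
rewrite imean_tuple; transitivity (\sum_(x : n.-tuple T | A x) Pr (B x))%E.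
  by rewrite (bigfs _ _ (r := index_enum _)) ?index_enum_uniq// => x _; rewrite mem_index_enum.
rewrite big_mkcond -sumEFin; apply: eq_bigr => x _; rewrite PB.
by case: (A x); rewrite ?mulr1 ?mulr0.
Qed.

End Sample.

(** * Uniform deviation inequality on the original space *)

Section Deviation.
Context (R : realType) (dS dO : measure_display) (S : measurableType dS)
  (Omega : measurableType dO).
Variables (Pr : probability Omega R) (P : probability S R).
Variables (n : nat) (X : 'I_n -> {RV Pr >-> S}).
Hypotheses (n0 : (0 < n)%N) (iidX : iid_sample P X).

Lemma measurable_mixture N (h : 'I_N -> S -> R) c :
  (forall j, measurable_fun setT (h j)) -> measurable_fun setT (mixture h c).
Proof.
move=> mh; apply: measurable_sum => j; exact: measurable_funM.
Qed.

(** Cells of width [1 / n] cost a bounded amount after summation: 2 for the empirical sum, 2 for the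
    mean and 8 for the offset, together 12. Comparing squares within a cell costs a factor 2, which
    turns [16 theta] into [32 theta] and [r2] into [2 r2 + 2 / n]. *)
Lemma deviation_event N m (h : 'I_N.+1 -> S -> R) (e : 'I_m -> S -> R)
  (b : 'M[R]_(N.+1, m)) (J : {set 'I_N.+1}) (u r2 theta a1 a2 t : R) (K : nat) :
  let q j x := h j x - \sum_k b j k * e k x in
  (forall j, measurable_fun setT (h j)) -> (forall j x, 0 <= h j x <= 1) ->
  (forall j, measurable_fun setT (q j)) -> (forall j x, `|q j x| <= u) -> 1 <= u ->
  0 <= r2 -> (forall j, j \in J -> rdot P (q j) (q j) <= r2) ->
  0 < theta -> theta <= 16^-1 -> 0 < a1 -> 0 < a2 ->
  exists E : set Omega, [/\ measurable E,
    ((1 - K.+1%:R * expR (- (theta * t)))%:E <= Pr E)%E &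
    forall w, E w -> forall c : 'rV[R]_N.+1, \sum_j `|c 0 j| <= 2 ->
      (forall x, `|mixture h c x| <= 1) ->
      \sum_i mixture h c (X i w) - n%:R * \int[P]_x mixture h c x <=
      32 * theta * n%:R * \int[P]_x (mixture h c x ^+ 2) +
      base_level n m N theta u (2 * r2 + 2 / n%:R) a2 +
      slope n N a1 * (2 * offdict J c + 2 / 2 ^+ K) + t + 12].
Proof.
move=> q mh h01 mq qu u1 r20 qr th0 th1 a10 a20.
have nR0 : 0 < n%:R :> R by rewrite ltr0n.
have n1 : 1 <= n%:R :> R by rewrite ler1n.
pose eta : R := n%:R^-1; have eta0 : 0 < eta by rewrite invr_gt0.
have eta1 : eta <= 1 by rewrite invf_le1.
(* Dictionary and residuals are cut together, so that [residual] on the finite space is the value of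
   [q] at the representative. *)
pose f (i : 'I_(N.+1 + N.+1)) := match fintype.split i with inl j => h j | inr j => q j end.
have mf i : measurable_fun setT (f i) by rewrite /f; case: (fintype.split i).
have fu i x : `|f i x| <= u.
  rewrite /f; case: (fintype.split i) => // j; have /andP[? ?] := h01 j x.
  by rewrite ger0_norm// (le_trans _ u1).
have [T [kappa [rep [mk frep]]]] := cells eta0 mf fu.
have hrep j x : `|h j x - h j (rep (kappa x))| <= eta.
  by have := frep (unsplit (inl j)) x; rewrite /f unsplitK.
have qrep j x : `|q j x - q j (rep (kappa x))| <= eta.
  by have := frep (unsplit (inr j)) x; rewrite /f unsplitK.
pose p := cellp P kappa.
have hp : fprob p by exact: cellp_fprob.
pose ht j s := h j (rep s); pose et k s := e k (rep s).
have ht1 j s : `|ht j s| <= 1.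
  by rewrite /ht; have /andP[? ?] := h01 j (rep s); rewrite ger0_norm.
have resE j s : residual ht et b j s = q j (rep s) by [].
have resu j s : j \in J -> `|residual ht et b j s| <= u by rewrite resE.
have res2 j : j \in J -> fmean p (fun s => residual ht et b j s ^+ 2) <= 2 * r2 + 2 / n%:R.
  move=> jJ; rewrite /p fmean_cellp//.
  have iq2 : P.-integrable setT (EFin \o (fun x => q j x ^+ 2)).
    apply: (@bounded_integrable _ _ _ _ _ (u ^+ 2)); first exact: measurable_funX.
    by move=> x; rewrite normrX lerXn2r ?nnegrE// (le_trans _ (qu j x)).
  apply: (@le_trans _ _ (\int[P]_x (2 * q j x ^+ 2 + cst (2 * eta) x))).
    apply: le_Rintegral => //.
    - exact: (cells_integrable P mk (fun s => residual ht et b j s ^+ 2)).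
    - apply: (@integrableD _ _ _ P setT measurableT (fun x => 2%:E * (q j x ^+ 2)%:E)%E (cst (2 * eta)%:E)).
        exact: integrableZl.
      exact: finite_measure_integrable_cst.
    move=> x _; rewrite resE /=; have := qrep j x.
    set y := q j (rep _); set z := q j x; rewrite ler_norml => /andP[yz1 yz2].
    have e2 : (z - y) ^+ 2 <= eta by have := eta0; nra.
    have := sqr_ge0 (2 * z - y); nra.
  rewrite RintegralD//; last 2 first.
    exact: (integrableZl measurableT 2 iq2).
    exact: finite_measure_integrable_cst.
  rewrite RintegralZl// Rintegral_cst// [X in fine X](_ : _ = 1%E); last exact: probability_setT.
  rewrite mulr1 lerD2r ler_pM2l//.
  apply: le_trans (qr j jJ); rewrite le_eqVlt; apply/orP; left; apply/eqP.
  by apply: eq_Rintegral => x _; rewrite expr2.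
have rho20 : 0 <= 2 * r2 + 2 / n%:R.
  by rewrite addr_ge0 ?mulr_ge0 ?divr_ge0.
(* Although quantified over all [c], this is a property of the code alone, hence a measurable
   event. *)
pose bad s := `[< exists2 c : 'rV_N.+1, oclass ht J 2 c &
          base_level n m N theta u (2 * r2 + 2 / n%:R) a2 +
          slope n N a1 * (2 * offdict J c + 2 / 2 ^+ K) + t <
          \sum_(x <- s) offset p ht theta c x >].
have u0 : 0 < u by rewrite (lt_le_trans ltr01).
have peel := offset_peeling n hp th0 th1 u0 a10 a20 ht1 resu rho20 res2 K t.
have [mE PE] := sample_event iidX mk (fun s => ~~ bad s).
exists [set w | ~~ bad (coded X kappa w)]; split => //.
  rewrite PE lee_fin.
  have hm := imean_mean hp n.
  rewrite (@mean_ext _ _ _ _ (fun s => 1 - (bad s)%:R)); last first.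
    by move=> s; case: (bad s); rewrite ?subrr ?subr0.
  by rewrite (meanB hm) (mean_cst hm) lerD2l lerN2.
move=> w /= /asboolPn good c c2 c1.
pose F := lcomb ht c.
have FE s : F s = mixture h c (rep s) by [].
have close x : `|mixture h c x - F (kappa x)| <= 2 * eta.
  rewrite FE /mixture -sumrB (le_trans (ler_norm_sum _ _ _))//.
  apply: (@le_trans _ _ (\sum_j `|c 0 j| * eta)).
    by apply: ler_sum => j _; rewrite -mulrBr normrM ler_wpM2l.
  by rewrite -mulr_suml ler_pM2r.
have : \sum_(x <- coded X kappa w) offset p ht theta c x <=
  base_level n m N theta u (2 * r2 + 2 / n%:R) a2 +
          slope n N a1 * (2 * offdict J c + 2 / 2 ^+ K) + t.
  rewrite leNgt; apply/negP => h2; apply: good; exists c => //; split=> //.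
    rewrite /offdict; apply: le_trans c2.
    by rewrite [leRHS](bigID (fun j => j \in ~: J)) /= lerDl sumr_ge0.
  by move=> s; rewrite -/F FE.
have -> : \sum_(x <- coded X kappa w) offset p ht theta c x =
    \sum_i offset p ht theta c (kappa (X i w)).
  by rewrite big_tuple; apply: eq_bigr => i _; rewrite tnth_mktuple.
rewrite /offset.
have -> : \sum_(i < n) (lcomb ht c (kappa (X i w)) - fmean p (lcomb ht c) -
      16 * theta * fmean p (fun s => lcomb ht c s ^+ 2)) =
    \sum_i F (kappa (X i w)) - n%:R * fmean p F -
    n%:R * (16 * theta * fmean p (fun s => F s ^+ 2)).
  by rewrite !sumrB !sumr_const card_ord !mulr_natl.
have mc : measurable_fun setT (mixture h c) by exact: measurable_mixture.
have ic : P.-integrable setT (EFin \o mixture h c) by exact: bounded_integrable c1.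
have ic2 : P.-integrable setT (EFin \o (fun x => mixture h c x ^+ 2)).
  apply: (@bounded_integrable _ _ _ _ _ 1); first exact: measurable_funX.
  by move=> x; rewrite normrX expr_le1.
have icst r : P.-integrable setT (EFin \o cst r) by exact: finite_measure_integrable_cst.
have Ecst r : \int[P]_x (cst r x) = r.
  by rewrite Rintegral_cst// [X in fine X](_ : _ = 1%E) ?mulr1//; exact: probability_setT.
have EF : fmean p F <= \int[P]_x mixture h c x + 2 * eta.
  rewrite /p fmean_cellp// -[X in _ + X]Ecst -RintegralD//.
  apply: le_Rintegral => //.
  - exact: (cells_integrable P mk F).
  - exact: (integrableD measurableT ic (icst _)).
  - by move=> x _ /=; have := close x; rewrite ler_norml; lra.
have EF2 : fmean p (fun x => F x ^+ 2) <= 2 * \int[P]_x (mixture h c x ^+ 2) + 8 * eta.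
  rewrite /p fmean_cellp// -[X in _ + X]Ecst -RintegralZl// -RintegralD//; last first.
    exact: (integrableZl measurableT 2 ic2).
  apply: le_Rintegral => //.
  - exact: (cells_integrable P mk (fun s => F s ^+ 2)).
  - exact: (integrableD measurableT (integrableZl measurableT 2 ic2) (icst _)).
  - move=> x _ /=; have := close x.
    set y := F _; set z := mixture h c x; rewrite ler_norml => /andP[yz1 yz2].
    have e2 : (z - y) ^+ 2 <= 4 * eta by have := eta0; nra.
    have := sqr_ge0 (2 * z - y); nra.
have sumX : \sum_i mixture h c (X i w) <= \sum_i F (kappa (X i w)) + 2.
  have -> : 2 = \sum_(i < n) 2 * eta.
    by rewrite sumr_const card_ord -(mulr_natl (2 * eta)) mulrCA mulfV ?mulr1// gt_eqF.
  rewrite -big_split ler_sum// => i _ /=; have := close (X i w); rewrite ler_norml; lra.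
have neta : n%:R * eta = 1 by rewrite mulfV// gt_eqF.
have : n%:R * fmean p F <= n%:R * \int[P]_x mixture h c x + 2.
  apply: (@le_trans _ _ (n%:R * (\int[P]_x mixture h c x + 2 * eta))).
    by rewrite ler_pM2l.
  rewrite mulrDr (mulrCA _ 2) neta; lra.
have : n%:R * (16 * theta * fmean p (fun x => F x ^+ 2)) <=
    32 * theta * n%:R * \int[P]_x (mixture h c x ^+ 2) + 8.
  apply: (@le_trans _ _ (n%:R * (16 * theta * (2 * \int[P]_x (mixture h c x ^+ 2) + 8 * eta)))).
    by rewrite ler_pM2l// ler_pM2l// mulr_gt0.
  have : theta * (n%:R * eta) <= 16^-1 by rewrite neta mulr1.
  lra.
lra.
Qed.

End Deviation.

(** * Entropy penalization over the simplex *)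

Section EntropyPenalization.
Context (R : realType) (N : nat).
Implicit Types l v w : 'rV[R]_N.

Definition entropy l := \sum_j l 0 j * ln (l 0 j).

Lemma simplex_le1 l j : simplex l -> l 0 j <= 1.
Proof.
by move=> [l0 l1]; rewrite -l1 (bigD1 j)//= lerDl sumr_ge0.
Qed.

Lemma simplex_segment l v t : simplex l -> simplex v -> 0 <= t <= 1 ->
  simplex (l + t *: (v - l)).
Proof.
move=> [l0 l1] [v0 v1] /andP[t0 t1]; split=> [j|].
  rewrite !mxE; have := l0 j; have := v0 j; nra.
have -> : \sum_j (l + t *: (v - l)) 0 j = \sum_j l 0 j + t * (\sum_j v 0 j - \sum_j l 0 j).
  rewrite mulrBr !mulr_sumr -sumrB -big_split; apply: eq_bigr => j _ /=.
  by rewrite !mxE mulrBr.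
by rewrite v1 l1 subrr mulr0 addr0.
Qed.

Lemma ln_le_sub1 (x : R) : 0 < x -> ln x <= x - 1.
Proof. by move=> x0; have := expR_ge1Dx (ln x); rewrite lnK ?posrE//; lra. Qed.

Lemma ln_tangent (x y : R) : 0 < x -> 0 < y -> x * (ln y - ln x) <= y - x.
Proof.
move=> x0 y0; rewrite -ln_div ?posrE//.
have := ln_le_sub1 (divr_gt0 y0 x0) => h.
apply: (@le_trans _ _ (x * (y / x - 1))); first by rewrite ler_pM2l.
by rewrite mulrBr mulrCA mulfV ?gt_eqF// !mulr1.
Qed.

(** * First-order conditions at a minimum point *)

Section Argmin.
Variables (Q : 'rV[R]_N -> R) (B : 'rV[R]_N -> 'rV[R]_N -> R) (f : 'rV[R]_N -> R).
Variables (eps : R) (l : 'rV[R]_N).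
Hypotheses (hQ : forall l w t, Q (l + t *: w) = Q l + 2 * t * B l w + t ^+ 2 * Q w)
  (hf : forall l w t, f (l + t *: w) = f l + t * f w) (eps0 : 0 < eps)
  (hl : is_argmin (@simplex R N) (fun l => Q l - 2 * f l + eps * entropy l) l).

(** The entropy is compared with its tangent at the moved point, not at [l], whose entries might
    vanish; the 1 in the gradient [1 + ln] drops out because the entries of [v - l] sum to zero. *)
Lemma argmin_variation v t : simplex v -> 0 < t < 1 ->
  0 <= 2 * B l (v - l) + t * Q (v - l) - 2 * f (v - l) +
    eps * \sum_j (v - l) 0 j * ln ((l + t *: (v - l)) 0 j).
Proof.
move=> sv /andP[t0 t1]; have [sl lmin] := hl; set w := v - l.
have sy : simplex (l + t *: w) by apply: simplex_segment => //; rewrite !ltW.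
have := lmin _ sy; rewrite hQ hf => le1.
have le2 : entropy (l + t *: w) - entropy l <=
    t * \sum_j w 0 j * ln ((l + t *: w) 0 j).
  have w0 : \sum_j w 0 j = 0.
    have [[_ l1] [_ v1]] := (sl, sv).
    transitivity (\sum_j v 0 j - \sum_j l 0 j); last by rewrite v1 l1 subrr.
    by rewrite -sumrB; apply: eq_bigr => j _; rewrite !mxE.
  apply: (@le_trans _ _ (\sum_j t * (w 0 j * (1 + ln ((l + t *: w) 0 j))))); last first.
    rewrite -mulr_sumr ler_pM2l//; under eq_bigr => j _ do rewrite mulrDr mulr1.
    by rewrite big_split /= w0 add0r.
  rewrite /entropy -sumrB; apply: ler_sum => j _.
  have [[l0 _] [v0 _]] := (sl, sv); have lj := l0 j; have vj := v0 j.
  have yE : (l + t *: w) 0 j = (1 - t) * l 0 j + t * v 0 j by rewrite !mxE; ring.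
  have twE : t * w 0 j = (l + t *: w) 0 j - l 0 j by rewrite !mxE; ring.
  rewrite mulrA twE; set y := (l + t *: w) 0 j in yE *; set x := l 0 j in lj yE *.
  have y0 : 0 <= y by rewrite yE; nra.
  have [y0'|yn0] := eqVneq y 0.
    have -> : x = 0 by nra.
    by rewrite y0' !(mul0r, subrr).
  have yp : 0 < y by rewrite lt_def yn0.
  have [->|xn0] := eqVneq x 0; first by rewrite mul0r !subr0 mulrDr mulr1; lra.
  have xp : 0 < x by rewrite lt_def xn0.
  have := ln_tangent xp yp; lra.
have : eps * (entropy (l + t *: w) - entropy l) <=
    eps * (t * \sum_j w 0 j * ln ((l + t *: w) 0 j)) by rewrite ler_pM2l.
move=> le3; rewrite -(pmulr_rge0 _ t0); nra.
Qed.

(** Moving from a zero entry towards the uniform weights gains a term of order [t ln t] in the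
    entropy, against costs of order [t]. *)
Lemma argmin_gt0 j : 0 < l 0 j.
Proof.
have [[l0 l1] _] := hl; rewrite lt_def l0 andbT; apply/negP => /eqP lj0.
have N0 : 0 < N%:R :> R by rewrite ltr0n; case: j {lj0} => j; case: (N).
have N1 : 1 <= N%:R :> R by rewrite ler1n -(ltr0n R).
have iN0 : 0 < N%:R^-1 :> R by rewrite invr_gt0.
pose v : 'rV[R]_N := \row_j N%:R^-1.
have sv : simplex v.
  split=> [i|]; first by rewrite mxE ltW.
  under eq_bigr => i _ do rewrite mxE.
  by rewrite sumr_const card_ord -(mulr_natr (N%:R^-1)) mulVf ?gt_eqF.
have lN0 : 0 <= ln N%:R :> R by rewrite ln_ge0.
pose c : R := `|2 * B l (v - l) - 2 * f (v - l)| + `|Q (v - l)| + eps * (N%:R * ln N%:R).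
have c0 : 0 <= c by rewrite /c !addr_ge0// mulr_ge0 ?(ltW eps0)// mulr_ge0// ltW.
(* This makes [eps ln t / N] equal to [- c - eps / N], while [c] bounds all other terms of the
   variation. *)
pose t := expR (- (N%:R / eps * c + 1)).
have T0 : 0 < N%:R / eps * c + 1 by rewrite ltr_wpDl// mulr_ge0// divr_ge0 ?ltW.
have t0 : 0 < t by exact: expR_gt0.
have t1 : t < 1 by rewrite /t expR_lt1 oppr_lt0.
have h := argmin_variation sv (introT andP (conj t0 t1)).
have sy : simplex (l + t *: (v - l)).
  by apply: simplex_segment => //; rewrite !ltW.
have le1 : \sum_i (v - l) 0 i * ln ((l + t *: (v - l)) 0 i) <=
    N%:R * ln N%:R + N%:R^-1 * ln t.
  rewrite (bigD1 j)//= addrC; apply: lerD.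
    apply: (@le_trans _ _ (\sum_(i < N | i != j) ln N%:R)).
      apply: ler_sum => i _; have y1 := simplex_le1 i sy.
      (* A growing coordinate contributes a nonpositive term; a shrinking one stays above its target
         [1 / N], so its logarithm is at least [- ln N]. *)
      have [wi|wi] := leP 0 ((v - l) 0 i).
        apply: (@le_trans _ _ 0) => //; rewrite mulr_ge0_le0//; exact: ln_le0.
      have yN : N%:R^-1 <= (l + t *: (v - l)) 0 i.
        by move: wi; rewrite !mxE; nra.
      have y0 := lt_le_trans iN0 yN.
      have : - ln N%:R <= ln ((l + t *: (v - l)) 0 i) by rewrite -lnV ?posrE// ler_ln ?posrE.
      have li1 : l 0 i <= 1 by exact: simplex_le1.
      have : -1 <= (v - l) 0 i by rewrite !mxE; lra.
      have : ln ((l + t *: (v - l)) 0 i) <= 0 by exact: ln_le0.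
      nra.
    rewrite sumr_const -(mulr_natl (ln _)) ler_wpM2r// ler_nat.
    by rewrite -[leqRHS](card_ord N) max_card.
  have -> : (l + t *: (v - l)) 0 j = t * N%:R^-1 by rewrite !mxE lj0; ring.
  have -> : (v - l) 0 j = N%:R^-1 by rewrite !mxE lj0 subr0.
  rewrite ler_pM2l// lnM ?posrE// lnV ?posrE//; lra.
have le2 := ler_wpM2l (ltW eps0) le1.
have tq : t * Q (v - l) <= `|Q (v - l)|.
  apply: (@le_trans _ _ (t * `|Q (v - l)|)); first by rewrite ler_pM2l// ler_norm.
  by rewrite ler_piMl// ltW.
have bf := ler_norm (2 * B l (v - l) - 2 * f (v - l)).
have lnt : eps * (N%:R^-1 * ln t) = - c - eps / N%:R.
  rewrite /t expRK; field; by rewrite !gt_eqF.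
have : 0 < eps / N%:R by rewrite divr_gt0.
move: le2; rewrite mulrDr lnt /c; lra.
Qed.

(** A quantitative form of [t -> 0]: for [t <= 1/2] the moved point stays above half of the positive
    [l], so the logarithms change by a multiple of [t], and a negative limit is refuted by a small
    [t]. *)
Lemma argmin_gradient v : simplex v ->
  0 <= 2 * B l (v - l) - 2 * f (v - l) + eps * \sum_j (v - l) 0 j * ln (l 0 j).
Proof.
move=> sv; set A := _ + _; have [[l0 l1] _] := hl.
pose k := Q (v - l) + eps * \sum_j 2 * (v - l) 0 j ^+ 2 / l 0 j.
have key t : 0 < t <= 2^-1 -> 0 <= A + t * k.
  move=> /andP[t0 t2].
  have := argmin_variation sv (_ : 0 < t < 1); rewrite t0 => /(_ _)/le_trans; apply.
    by apply: le_lt_trans t2 _; lra.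
  suff : \sum_j (v - l) 0 j * ln ((l + t *: (v - l)) 0 j) <=
     \sum_j (v - l) 0 j * ln (l 0 j) + t * \sum_j 2 * (v - l) 0 j ^+ 2 / l 0 j.
    move=> /(ler_wpM2l (ltW eps0)); rewrite /A /k; lra.
  rewrite mulr_sumr -big_split; apply: ler_sum => j _ /=.
  have lj := argmin_gt0 j; have [v0 _] := sv; have vj := v0 j.
  set w := (v - l) 0 j; have wE : w = v 0 j - l 0 j by rewrite /w !mxE.
  have -> : (l + t *: (v - l)) 0 j = l 0 j + t * w by rewrite !mxE /w !mxE.
  set x := l 0 j in lj wE *.
  have yx : 2^-1 * x <= x + t * w by rewrite wE; nra.
  have y0 : 0 < x + t * w by apply: lt_le_trans yx; rewrite mulr_gt0.
  rewrite -lerBlDl -mulrBr.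
  have [w0|w0] := leP 0 w.
    apply: (@le_trans _ _ (w * (t * w / x))).
      rewrite ler_wpM2l// ler_pdivlMr// mulrC.
      have := ln_tangent lj y0; lra.
    have -> : w * (t * w / x) = t * (w ^+ 2 / x) by ring.
    rewrite -[2 * _ / _]mulrA ler_pM2l// ler_peMl// ?ler1n//.
    by rewrite divr_ge0 ?sqr_ge0// ltW.
  have le1 : ln x - ln (x + t * w) <= - t * w / (x + t * w).
    rewrite ler_pdivlMr// mulrC; have := ln_tangent y0 lj; lra.
  have le2 : - t * w / (x + t * w) <= - t * w * (2 / x).
    rewrite ler_pM2l; last by nra.
    by rewrite -[2 / x]invrK invf_div lef_pV2 ?posrE ?divr_gt0//; lra.
  have -> : t * (2 * w ^+ 2 / x) = - w * (- t * w * (2 / x)) by ring.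
  rewrite -mulrNN opprB ler_pM2l ?oppr_gt0//; exact: le_trans le1 le2.
rewrite leNgt; apply/negP => A0.
have [k0|k0] := leP k 0.
  have := key 2^-1; rewrite lexx invr_gt0 ltr0n => /(_ isT); nra.
pose t := Num.min 2^-1 (- A / (2 * k)).
have t0 : 0 < t by rewrite lt_min invr_gt0 ltr0n /= divr_gt0 ?oppr_gt0// mulr_gt0.
have := key t; rewrite t0 ge_min lexx /= => /(_ isT).
have : t * k <= - A / 2.
  apply: (@le_trans _ _ (- A / (2 * k) * k)).
    by rewrite ler_pM2r// ge_min lexx orbT.
  by rewrite invfM mulrA divfK ?gt_eqF.
lra.
Qed.

End Argmin.

(** The condition at [l] in the direction [w = l' - l] and the one at [l'] in the direction [- w]
    are added; bilinearity turns [B l' w - B l w] into [Q w]. *)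
Lemma argmin_comparison (Q : 'rV[R]_N -> R) (B : 'rV[R]_N -> 'rV[R]_N -> R)
  (f f' : 'rV[R]_N -> R) (eps : R) (l l' : 'rV[R]_N) :
  (forall l w t, Q (l + t *: w) = Q l + 2 * t * B l w + t ^+ 2 * Q w) ->
  (forall l w v t, B (l + t *: w) v = B l v + t * B w v) ->
  (forall l v, B l v = B v l) -> (forall l, Q l = B l l) ->
  (forall l w t, f (l + t *: w) = f l + t * f w) ->
  (forall l w t, f' (l + t *: w) = f' l + t * f' w) -> 0 < eps ->
  is_argmin (@simplex R N) (fun l => Q l - 2 * f l + eps * entropy l) l ->
  is_argmin (@simplex R N) (fun l => Q l - 2 * f' l + eps * entropy l) l' ->
  2 * Q (l' - l) + eps * \sum_j (l' 0 j - l 0 j) * (ln (l' 0 j) - ln (l 0 j)) <=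
  2 * (f' (l' - l) - f (l' - l)).
Proof.
move=> hQ hB Bsym QB hf hf' eps0 hl hl'.
have := argmin_gradient hQ hf eps0 hl hl'.1.
have := argmin_gradient hQ hf' eps0 hl' hl.1.
set w := l' - l; have -> : l - l' = 0 + (-1) *: w by rewrite add0r scaleN1r opprB.
have f'0 : f' 0 = 0 by have := hf' 0 0 1; rewrite scaler0 addr0; lra.
have B0 v : B 0 v = 0 by have := hB 0 0 v 1; rewrite scaler0 addr0; lra.
rewrite hf' f'0 (Bsym l') hB B0 (Bsym w) => g1 g2.
have Bl' : B l' w = B l w + Q w.
  have {1}-> : l' = l + 1 *: w by rewrite scale1r addrC subrK.
  by rewrite hB mul1r QB.
have e1 : \sum_j w 0 j * ln (l' 0 j) = - \sum_j (0 + -1 *: w) 0 j * ln (l' 0 j).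
  by rewrite -sumrN; apply: eq_bigr => j _; rewrite !mxE; ring.
have e2 : \sum_j (l' 0 j - l 0 j) * (ln (l' 0 j) - ln (l 0 j)) =
    \sum_j w 0 j * ln (l' 0 j) - \sum_j w 0 j * ln (l 0 j).
  by rewrite -sumrB; apply: eq_bigr => j _; rewrite !mxE; ring.
rewrite e2 e1; lra.
Qed.

End EntropyPenalization.

(** * Mixtures *)

Section Mixtures.
Context (R : realType) (S : Type) (N : nat) (h : 'I_N -> S -> R).

Lemma mixture_lin l w t x :
  mixture h (l + t *: w) x = t * mixture h w x + mixture h l x.
Proof.
rewrite /mixture mulr_sumr -big_split; apply: eq_bigr => j _ /=.
by rewrite !mxE; ring.
Qed.

Lemma mixtureB l l' x : mixture h (l' - l) x = mixture h l' x - mixture h l x.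
Proof. by rewrite -scaleN1r mixture_lin; ring. Qed.

Hypothesis h01 : forall j x, 0 <= h j x <= 1.

Lemma mixture_01 l x : simplex l -> 0 <= mixture h l x <= 1.
Proof.
move=> [l0 l1]; apply/andP; split.
  by apply: sumr_ge0 => j _; have /andP[? _] := h01 j x; rewrite mulr_ge0.
by rewrite -l1; apply: ler_sum => j _; have /andP[_ ?] := h01 j x; rewrite ler_piMr.
Qed.

Lemma mixtureB_le1 l l' x : simplex l -> simplex l' -> `|mixture h (l' - l) x| <= 1.
Proof.
move=> /(mixture_01 x)/andP[? ?] /(mixture_01 x)/andP[? ?].
by rewrite mixtureB ler_norml; lra.
Qed.

End Mixtures.

Lemma simplexB_norm (R : realType) N (l l' : 'rV[R]_N) :
  simplex l -> simplex l' -> \sum_j `|(l' - l) 0 j| <= 2.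
Proof.
move=> [l0 l1] [l0' l1'].
have -> : 2 = \sum_j (l' 0 j + l 0 j) by rewrite big_split /= l1 l1'.
apply: ler_sum => j _; rewrite !mxE (le_trans (ler_normB _ _))//.
by rewrite !ger0_norm.
Qed.

(** * Mixtures in [L_2(mu)] and the comparison of [P] with [mu] *)

Section MeasureSide.
Context (R : realType) (dS : measure_display) (S : measurableType dS).
Variable mu : {measure set S -> \bar R}.

(** On measurable sets [P <= M mu], and integrals of nonnegative functions are monotone in the
    measure. *)
Lemma density_integral_le (P : probability S R) fs (M : R) (f : S -> R) :
  0 <= M -> has_density mu P fs -> (forall x, fs x <= M) ->
  measurable_fun setT f -> (forall x, 0 <= f x) ->
  (\int[P]_x (f x)%:E <= M%:E * \int[mu]_x (f x)%:E)%E.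
Proof.
move=> M0 [mfs fs0 PE] fsM mf f0.
have mEf : measurable_fun setT (EFin \o f) by exact/measurable_EFinP.
have -> : (M%:E * \int[mu]_x (f x)%:E = \int[mscale (NngNum M0) mu]_x (f x)%:E)%E.
  by rewrite ge0_integral_mscale//= => x _; rewrite lee_fin.
apply: ge0_le_measure_integral => //.
move=> B mB.
suff : (\int[mu]_(x in B) (fs x)%:E <= M%:E * mu B)%E by rewrite -(PE B mB).
rewrite -integral_cst//; apply: ge0_le_integral => //.
- by move=> x _; rewrite lee_fin.
- apply/measurable_EFinP; exact: measurable_funTS.
- by move=> x _; rewrite lee_fin.
Qed.

Context (N : nat) (h : 'I_N -> S -> R).
Hypotheses (dh : forall j, probability_density mu (h j)) (h1 : forall j x, h j x <= 1).

(** [0 <= h j <= 1] gives [h^2 <= h], whose integral is 1. *)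
Lemma dictionary_Lfun2 j : h j \in Lfun mu 2%:E.
Proof.
have [mh h0 ih] := dh j.
apply: Lfun2P => //; apply: (@le_integrable _ _ _ mu setT measurableT _ (EFin \o h j)).
- by apply/measurable_EFinP; exact: measurable_funX.
- move=> x _ /=; rewrite lee_fin !ger0_norm ?sqr_ge0// expr2.
  by rewrite ler_piMr.
- apply/integrableP; split; first exact/measurable_EFinP.
  under eq_integral => x _ do rewrite /= ger0_norm//.
  by rewrite ih ltry.
Qed.

Lemma mixture_Lfun2 c : mixture h c \in Lfun mu 2%:E.
Proof. by apply: Lfun2_sum => j; exact: dictionary_Lfun2. Qed.

Definition mixdot c c' := rdot mu (mixture h c) (mixture h c').

Lemma mixdotC c c' : mixdot c c' = mixdot c' c.
Proof. exact: rdotC. Qed.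

Lemma mixdotDl l w v t : mixdot (l + t *: w) v = mixdot l v + t * mixdot w v.
Proof.
rewrite [RHS]addrC /mixdot -rdot_linl ?mixture_Lfun2//.
by congr (rdot _ _ _); apply/funext => x; rewrite mixture_lin.
Qed.

Lemma mixdot_quad l w t : mixdot (l + t *: w) (l + t *: w) =
  mixdot l l + 2 * t * mixdot l w + t ^+ 2 * mixdot w w.
Proof.
by rewrite mixdotDl !(mixdotC _ (l + t *: w)) !mixdotDl (mixdotC w l); ring.
Qed.

Lemma penalized_riskE eps Q l : penalized_risk mu h eps Q l =
  mixdot l l - 2 * Q (mixture h l) + eps * entropy l.
Proof.
rewrite /penalized_risk (Lnorm2E (mixture_Lfun2 l)) /= sqr_sqrtr ?rdot_ge0//.
Qed.

End MeasureSide.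

Lemma symKLE (R : realType) N (l l' : 'rV[R]_N) :
  (forall j, 0 < l 0 j) -> (forall j, 0 < l' 0 j) ->
  symKL l' l = (\sum_j (l' 0 j - l 0 j) * (ln (l' 0 j) - ln (l 0 j)))%:E.
Proof.
move=> l0 l0'.
have KLE (v w : 'rV[R]_N) : (forall j, 0 < v 0 j) -> (forall j, 0 < w 0 j) ->
    KL v w = (\sum_j v 0 j * (ln (v 0 j) - ln (w 0 j)))%:E.
  move=> v0 w0; rewrite /KL -sumEFin; apply: eq_bigr => j _.
  by rewrite !gt_eqF// ln_div ?posrE.
rewrite /symKL !KLE// -EFinD -big_split; congr EFin; apply: eq_bigr => j _ /=; ring.
Qed.

(** * Numerical bounds *)

Section Numerics.
Context (R : realType).

(** The quadratic bound at [1/2] reads [expR (1/2) <= 2]. *)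
Lemma ln2_ge_half : 2^-1 <= ln 2 :> R.
Proof.
rewrite -[leLHS]expRK ler_ln ?posrE ?expR_gt0//.
by have := @expR_le_quad R _ (lexx 2^-1); lra.
Qed.

(** With [K] the rounded-up binary logarithm of [n], the last level is at most [2 / n], and [K + 1
    <= 2 + 2 ln n <= 4 N^(1/gamma) <= N^(2 + 1/gamma)]. *)
Lemma dyadic_count (gamma : R) (n N : nat) : 0 < gamma -> (0 < n)%N -> (1 < N)%N ->
  ln n%:R `^ gamma <= N%:R ->
  exists2 K, n%:R <= 2 ^+ K :> R & K.+1%:R <= expR ((2 + gamma^-1) * ln N%:R).
Proof.
move=> g0 n0 N1 hN; have N0 : 0 < N%:R :> R by rewrite ltr0n ltnW.
have ln0 : 0 <= ln n%:R :> R by rewrite ln_ge0// ler1n.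
have lnle : ln n%:R <= expR (gamma^-1 * ln N%:R).
  have gi0 : 0 <= gamma^-1 by rewrite invr_ge0 ltW.
  have := @ge0_ler_powR R _ gi0 _ _ (powR_ge0 _ _) (ltW N0) hN.
  by rewrite -powRrM mulfV ?gt_eqF// powRr1// /powR gt_eqF.
exists (up_log 2 n).
  by rewrite -natrX ler_nat up_logP.
have Kle : (up_log 2 n)%:R <= 1 + 2 * ln n%:R :> R.
  have [->|n1] := eqVneq n 1%N; first by rewrite up_log1 ln1 mulr0 addr0.
  have n1' : (1 < n)%N by rewrite ltn_neqAle eq_sym n1.
  have : (2 ^ (up_log 2 n).-1 < n)%N by have /andP[] := up_log_bounds (isT : (1 < 2)%N) n1'.
  rewrite -(ltr_nat R) natrX => /ltW lt1.
  have le2 : ln (2 : R) *+ (up_log 2 n).-1 <= ln n%:R.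
    by rewrite -lnXn// ler_ln ?posrE ?exprn_gt0 ?ltr0n.
  have : (up_log 2 n).-1%:R * 2^-1 <= ln n%:R :> R.
    apply: le_trans le2; rewrite -(mulr_natl (ln 2)) ler_wpM2l//; exact: ln2_ge_half.
  have : (up_log 2 n)%:R <= (up_log 2 n).-1%:R + 1 :> R.
    by rewrite natr1 ler_nat leqSpred.
  lra.
have e0 : 0 <= gamma^-1 * ln N%:R.
  by rewrite mulr_ge0 ?invr_ge0 ?(ltW g0)// ln_ge0// ler1n ltnW.
have e1 : 1 <= expR (gamma^-1 * ln N%:R) by apply: le_trans (expR_ge1Dx _); rewrite lerDl.
rewrite mulrDl expRD mulrC -natr1.
have -> : expR (2 * ln N%:R) = N%:R ^+ 2 :> R.
  by rewrite expRM_natl lnK// posrE.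
have N2 : 4 <= N%:R ^+ 2 :> R by rewrite -natrX ler_nat (leq_exp2r 2 N (isT : (0 < 2)%N)).
have := ler_pM (ltW (expR_gt0 _)) _ (lexx (expR (gamma^-1 * ln N%:R))) N2; nra.
Qed.

(** * Choice of the scales in the maximal inequalities *)

Section Levels.
Variables (n m N : nat) (M u r sg : R).
Hypotheses (n0 : (0 < n)%N) (N2 : (1 < N.+1)%N) (M1 : 1 <= M) (u1 : 1 <= u) (r0 : 0 <= r)
  (sg0 : 0 < sg) (sgE : sg ^+ 2 * n%:R = ln N.+1%:R).
Let l : R := ln N.+1%:R.

Lemma ln_dict_ge : ln 2 <= l.
Proof. by rewrite ler_ln ?posrE ?ltr0n// ler_nat. Qed.

Let l2 : 2^-1 <= l. Proof. exact: le_trans ln2_ge_half ln_dict_ge. Qed.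

(** The scale [1 / s] with [s = u + r / sg] balances the maximal inequality: the variance proxy is
    at most [14 l s^2], which leaves [8 (2 + 28) l s = 240 l s], and [l s = u l + n sg r]. *)
Lemma base_level_le :
  base_level n m N (64 * M)^-1 u (2 * r ^+ 2 + 2 / n%:R) (u + r / sg)^-1 <=
  32 * M * m%:R + 240 * (u * l + n%:R * sg * r).
Proof.
have nR0 : 0 < n%:R :> R by rewrite ltr0n.
have [v1 l2' M1'] : [/\ 1 <= u, 2^-1 <= l & 1 <= M] by [].
pose y := r / sg; have y0 : 0 <= y by rewrite divr_ge0// ltW.
have rE : r = y * sg by rewrite /y divfK ?gt_eqF.
rewrite /base_level -/l -/y; set s := u + y.
have s1 : 1 <= s by rewrite /s; lra.
have s0 : 0 < s by lra.
have nr2 : n%:R * r ^+ 2 = l * y ^+ 2 by rewrite rE exprMn /l -sgE; ring.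
have W : 2 * n%:R * (2 * r ^+ 2 + 2 / n%:R) = 4 * (l * y ^+ 2) + 4.
  by rewrite -nr2; field; rewrite gt_eqF.
rewrite W invrK; set W' := 2 * u ^+ 2 * l + _.
have W'le : W' <= 14 * l * s ^+ 2.
  have us : u ^+ 2 <= s ^+ 2 by rewrite lerXn2r ?nnegrE /s; lra.
  have ys : y ^+ 2 <= s ^+ 2 by rewrite lerXn2r ?nnegrE /s; lra.
  have ss : 1 <= s ^+ 2 by rewrite exprn_ege1.
  have k1 : u ^+ 2 * l <= s ^+ 2 * l by rewrite ler_wpM2r//; lra.
  have k2 : l * y ^+ 2 <= l * s ^+ 2 by rewrite ler_wpM2l//; lra.
  have k3 : l * 1 <= l * s ^+ 2 by rewrite ler_wpM2l//; lra.
  rewrite /W'; lra.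
have -> : m%:R / (2 * (64 * M)^-1) = 32 * M * m%:R :> R.
  by field; rewrite gt_eqF//; lra.
rewrite lerD2l.
have -> : n%:R * sg * r = l * y by rewrite rE /l -sgE; ring.
have k4 : (s^-1 ^+ 2 * W') * s <= 14 * l * s.
  have -> : (s^-1 ^+ 2 * W') * s = W' / s by field; rewrite gt_eqF.
  by rewrite ler_pdivrMr// -[_ * s * s]mulrA -expr2.
have := ln_dict_ge; rewrite -/l => l2l.
have k5 : (l + ln 2) * s <= (2 * l) * s by rewrite ler_pM2r//; lra.
have -> : u * l + l * y = l * s by rewrite /s; ring.
lra.
Qed.

(** [sg] is the balanced scale: [2 sg^2 n = 2 l], so the numerator is at most [4 l], and
    [l / sg = n sg]. *)
Lemma slope_le : slope n N sg <= 16 * (n%:R * sg).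
Proof.
rewrite /slope -/l; have := ln_dict_ge; rewrite -/l => l2l.
have -> : n%:R * sg = l / sg by rewrite /l -sgE; field; rewrite gt_eqF.
rewrite (_ : 16 * (l / sg) = 4 * ((4 * l) / sg)); last by ring.
rewrite ler_pM2l// ler_pM2r ?invr_gt0//.
have : sg ^+ 2 * n%:R = l by [].
lra.
Qed.

Lemma sg_le : sg <= 2 * l.
Proof.
have n1 : 1 <= n%:R :> R by rewrite ler1n.
have : sg ^+ 2 <= l by rewrite /l -sgE ler_peMr// sqr_ge0.
have := l2; nra.
Qed.

End Levels.

(** Here [a] and [b] are the masses of the two points outside [J], and [K] is their symmetrized
    divergence. As [C1 tau <= eps / 16], [4 K] returns only a quarter of [r + a + b] besides the
    remainder, so [a] is bounded through [b] and conversely; inserted in the hypothesis, this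
    removes [a] from the last bound. *)
Lemma absorption (C1 eps tau r a b K V W : R) :
  1 <= C1 -> 0 < eps -> 0 <= tau -> 16 * C1 * tau <= eps -> 0 <= r -> 0 <= a -> 0 <= b ->
  0 <= V -> 0 <= W -> V + eps * K <= C1 * (W + r * tau + tau * (a + b)) ->
  a <= 2 * b + 4 * K -> b <= 2 * a + 4 * K ->
  [/\ a <= 16 * C1 * (b + W / eps + r), b <= 16 * C1 * (a + W / eps + r) &
      V + eps * K <= 4 * C1 * (W + r * tau + tau * b)].
Proof.
move=> C10 e0 t0 te r0 a0 b0 V0 W0 h ha hb.
set k := W / eps; have k0 : 0 <= k by rewrite divr_ge0// ltW.
have WE : W = eps * k by rewrite /k mulrCA mulfV ?mulr1// gt_eqF.
have Kle : K <= C1 * k + (r + a + b) / 16.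
  rewrite -(ler_pM2l e0).
  have : C1 * tau * (r + a + b) <= eps / 16 * (r + a + b) by rewrite ler_wpM2r//; lra.
  rewrite WE in h; lra.
have Ck : 0 <= C1 * k by rewrite mulr_ge0//; lra.
have Cb : b <= C1 * b by rewrite ler_peMl.
have Ca : a <= C1 * a by rewrite ler_peMl.
have Cr : r <= C1 * r by rewrite ler_peMl.
have a3 : a <= 3 * b + 6 * (C1 * k) + r by lra.
split; [lra|lra|].
have : tau * a <= tau * (3 * b + 6 * (C1 * k) + r) by rewrite ler_wpM2l.
have : 16 * C1 * tau * k <= eps * k by rewrite ler_wpM2r.
rewrite -WE => h1 h2.
apply: le_trans h _; rewrite [4 * C1]mulrC -mulrA ler_wpM2l//; first lra.
have := mulr_ge0 t0 b0; have := mulr_ge0 r0 t0; lra.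
Qed.

End Numerics.

(** * The oracle inequality *)

(* [N] to the power [2 + gamma^-1] bounds the number of slices of the peeling. *)
Definition oracle_const (R : realType) (gamma : R) : R := 784 + 128 * (2 + gamma^-1).

Lemma oracle_const_ge1 (R : realType) (gamma : R) : 0 < gamma -> 1 <= oracle_const gamma.
Proof. by rewrite -invr_gt0 /oracle_const; lra. Qed.

Section Oracle.
Context (R : realType) (gamma : R) (dS dO : measure_display) (S : measurableType dS)
  (Omega : measurableType dO) (Pr : probability Omega R) (P : probability S R)
  (mu : {measure set S -> \bar R}) (n N : nat) (X : 'I_n -> {RV Pr >-> S})
  (fstar : S -> R) (M : R) (h : 'I_N.+1 -> S -> R) (eps A : R)
  (lhat : Omega -> 'rV[R]_N.+1) (l : 'rV[R]_N.+1) (J : {set 'I_N.+1}).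
Hypotheses (g0 : 0 < gamma) (n0 : (0 < n)%N) (N2 : (1 < N.+1)%N)
  (hN : ln n%:R `^ gamma <= N.+1%:R) (iidX : iid_sample P X)
  (hP : has_density mu P fstar) (M1 : 1 <= M) (fM : forall x, fstar x <= M)
  (dh : forall j, probability_density mu (h j)) (h1 : forall j x, h j x <= 1)
  (A1 : 1 <= A) (eps0 : 0 < eps)
  (hlhat : forall w, is_argmin (@simplex R N.+1)
     (penalized_risk mu h eps (empirical_mean (fun i => X i w))) (lhat w))
  (hl : is_argmin (@simplex R N.+1)
     (penalized_risk mu h eps (fun g => \int[P]_x g x)) l).

Let dict_measurable j : measurable_fun setT (h j). Proof. by case: (dh j). Qed.
Let dict01 j x : 0 <= h j x <= 1. Proof. by rewrite h1 andbT; case: (dh j). Qed.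

Lemma mixture_integrable c : P.-integrable setT (EFin \o mixture h c).
Proof.
apply: (@bounded_integrable _ _ _ _ _ (\sum_j `|c 0 j|)).
  exact: measurable_mixture.
move=> x; apply: le_trans (ler_norm_sum _ _ _) _; apply: ler_sum => j _.
by rewrite normrM ler_piMr// ger0_norm//; have /andP[] := dict01 j x.
Qed.

Lemma integral_mixture_lin c w t :
  \int[P]_x mixture h (c + t *: w) x =
  \int[P]_x mixture h c x + t * \int[P]_x mixture h w x.
Proof.
rewrite [RHS]addrC -RintegralZl//; last exact: mixture_integrable.
rewrite -RintegralD//; last 2 first.
- exact: (integrableZl measurableT t (mixture_integrable w)).
- exact: mixture_integrable.
by apply: eq_Rintegral => x _; rewrite mixture_lin.
Qed.

Lemma empirical_mixture_lin w c v t :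
  empirical_mean (fun i => X i w) (mixture h (c + t *: v)) =
  empirical_mean (fun i => X i w) (mixture h c) +
  t * empirical_mean (fun i => X i w) (mixture h v).
Proof.
rewrite /empirical_mean; under eq_bigr => i _ do rewrite mixture_lin.
by rewrite big_split /= -mulr_sumr; ring.
Qed.

Lemma argmin_mixdot Q c : is_argmin (@simplex R N.+1) (penalized_risk mu h eps Q) c ->
  is_argmin (@simplex R N.+1)
    (fun c => mixdot mu h c c - 2 * Q (mixture h c) + eps * entropy c) c.
Proof.
by move=> [sc cmin]; split=> // c' sc'; have := cmin c' sc'; rewrite !penalized_riskE.
Qed.

Lemma estimator_gt0 w j : 0 < lhat w 0 j.
Proof.
exact: (argmin_gt0 (mixdot_quad dh h1) (empirical_mixture_lin w) eps0
  (argmin_mixdot (hlhat w))).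
Qed.

Lemma oracle_gt0 j : 0 < l 0 j.
Proof.
exact: (argmin_gt0 (mixdot_quad dh h1) integral_mixture_lin eps0 (argmin_mixdot hl)).
Qed.

Definition sym_entropy w :=
  \sum_j (lhat w 0 j - l 0 j) * (ln (lhat w 0 j) - ln (l 0 j)).

Lemma basic_inequality w : 2 * mixdot mu h (lhat w - l) (lhat w - l) +
    eps * sym_entropy w <=
  2 * (empirical_mean (fun i => X i w) (mixture h (lhat w - l))
       - \int[P]_x mixture h (lhat w - l) x).
Proof.
exact: (argmin_comparison (mixdot_quad dh h1) (mixdotDl dh h1) (mixdotC mu h)
  (fun _ => erefl) integral_mixture_lin (empirical_mixture_lin w) eps0
  (argmin_mixdot hl) (argmin_mixdot (hlhat w))).
Qed.

Lemma integral_sqr_mixture_le c :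
  \int[P]_x (mixture h c x ^+ 2) <= M * mixdot mu h c c.
Proof.
have M0 : 0 <= M by rewrite (le_trans ler01).
have mc : measurable_fun setT (mixture h c) by exact: measurable_mixture.
have := density_integral_le M0 hP fM (measurable_funX 2 mc) (fun x => sqr_ge0 _).
have imu := rdot_integrable (mixture_Lfun2 dh h1 c) (mixture_Lfun2 dh h1 c).
have -> : (\int[mu]_x (mixture h c x ^+ 2)%:E = (mixdot mu h c c)%:E)%E.
  rewrite /mixdot /rdot /Rintegral fineK; first by apply: eq_integral => x _; rewrite expr2.
  exact: integrable_fin_num.
have : (0 <= \int[P]_x (mixture h c x ^+ 2)%:E)%E.
  by apply: integral_ge0 => x _; rewrite lee_fin sqr_ge0.
rewrite -EFinM /Rintegral; set I := integral _ _ _.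
by case: I => [y _|//|//]; rewrite lee_fin.
Qed.

Variables (m : nat) (e : 'I_m -> S -> R) (b : 'M[R]_(N.+1, m)) (u r : R).
Let q j x := h j x - \sum_k b j k * e k x.
Hypotheses (mq : forall j, measurable_fun setT (q j)) (qu : forall j x, `|q j x| <= u)
  (u1 : 1 <= u) (r0 : 0 <= r)
  (qr : forall j, j \in J -> rdot P (q j) (q j) <= r ^+ 2).

Let lN : R := ln N.+1%:R.

(** The deviation bound is inserted into [basic_inequality]. The mass of [lhat] outside [J] still
    stands on the right, to be removed by [absorption]. *)
Lemma oracle_event : exists E : set Omega, [/\ measurable E,
  ((1 - N.+1%:R `^ (- A))%:E <= Pr E)%E &
  forall w, E w ->
    mixdot mu h (lhat w - l) (lhat w - l) + eps * sym_entropy w <=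
    oracle_const gamma * (M ^+ 2 * ((m%:R + A * lN) / n%:R) + u * (lN / n%:R) +
      r * Num.sqrt (A * lN / n%:R) +
      Num.sqrt (A * lN / n%:R) *
        (\sum_(j in ~: J) lhat w 0 j + \sum_(j in ~: J) l 0 j))].
Proof.
have nR0 : 0 < n%:R :> R by rewrite ltr0n.
have lN2 : 2^-1 <= lN by exact: le_trans (ln2_ge_half R) (ln_dict_ge _ N2).
have lN0 : 0 < lN by apply: lt_le_trans lN2; rewrite invr_gt0.
pose sg := Num.sqrt (lN / n%:R).
have sg0 : 0 < sg by rewrite sqrtr_gt0 divr_gt0.
have sgE : sg ^+ 2 * n%:R = ln N.+1%:R.
  by rewrite sqr_sqrtr ?divfK ?gt_eqF// divr_ge0// ltW.
have sgtau : sg <= Num.sqrt (A * lN / n%:R).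
  by apply: ler_wsqrtr; rewrite ler_pM2r ?invr_gt0// ler_peMl// ltW.
set tau := Num.sqrt (A * lN / n%:R) in sgtau *.
have [K nK KG] := dyadic_count g0 n0 N2 hN.
set G := 2 + gamma^-1 in KG.
have G2 : 2 <= G by rewrite /G lerDl invr_ge0 ltW.
have [M1' [A1' [u1' r0']]] : 1 <= M /\ 1 <= A /\ 1 <= u /\ 0 <= r by [].
have M0 : 0 < M by exact: lt_le_trans M1.
(* By [P <= M mu], [32 theta n P g^2] is at most [n ||g||_mu^2 / 2]; doubled, it takes half of the
   quadratic term on the left. *)
have th0 : 0 < (64 * M)^-1 by rewrite invr_gt0 mulr_gt0.
have th1 : (64 * M)^-1 <= 16^-1 by rewrite lef_pV2 ?posrE ?mulr_gt0//; lra.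
have s0 : 0 < (u + r / sg)^-1.
  by rewrite invr_gt0 ltr_wpDr ?(lt_le_trans ltr01)// divr_ge0// ltW.
(* [theta t = (A + G) ln N]: the number of slices, at most [N^G], leaves the probability
   [N^(-A)]. *)
pose t := 64 * M * ((A + G) * lN).
have [E [mE PE hE]] := deviation_event n0 iidX t K dict_measurable dict01 mq qu u1
  (sqr_ge0 r) qr th0 th1 sg0 s0.
exists E; split=> //.
  apply: le_trans PE; rewrite lee_fin lerD2l lerN2.
  apply: (@le_trans _ _ (expR (G * lN) * expR (- ((64 * M)^-1 * t)))).
    by rewrite ler_wpM2r ?expR_ge0.
  rewrite -expRD /powR gt_eqF ?ltr0n// ler_expR /t mulKf; last by rewrite gt_eqF// mulr_gt0.
  rewrite -/lN; lra.
move=> w Ew; have [[shat _] [sl _]] := (hlhat w, hl).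
set c := lhat w - l.
have := hE w Ew c (simplexB_norm sl shat) (fun x => mixtureB_le1 dict01 x sl shat).
set PF := \int[P]_x mixture h c x; set PF2 := \int[P]_x (mixture h c x ^+ 2).
have := basic_inequality w; rewrite -/c /empirical_mean -/PF.
set SF := \sum_i _; set V := mixdot mu h c c => basic dev.
have PF2le : PF2 <= M * V by exact: integral_sqr_mixture_le.
have V0 : 0 <= V by exact: rdot_ge0.
have base := @base_level_le R n m N M u r sg n0 N2 M1 u1 r0 sg0 sgE.
have slp := @slope_le R n N sg N2 sg0 sgE.
have sgl := @sg_le R n N sg n0 N2 sgE.
rewrite -/lN in base sgl.
set a := \sum_(j in ~: J) lhat w 0 j; set bb := \sum_(j in ~: J) l 0 j.
have Dle : offdict J c <= a + bb.
  rewrite /offdict /a /bb -big_split; apply: ler_sum => j _.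
  rewrite !mxE (le_trans (ler_normB _ _))//.
  by rewrite !ger0_norm// ltW ?estimator_gt0 ?oracle_gt0.
have D0 : 0 <= offdict J c by rewrite /offdict sumr_ge0.
have dK : 2 / 2 ^+ K <= 2 / n%:R :> R.
  by rewrite ler_pM2l// lef_pV2 ?posrE ?exprn_gt0.
have slp2 : slope n N sg * (2 * offdict J c + 2 / 2 ^+ K) <=
    32 * (n%:R * sg) * (a + bb) + 64 * lN.
  apply: (@le_trans _ _ (16 * (n%:R * sg) * (2 * (a + bb) + 2 / n%:R))).
    apply: ler_pM => //; first exact: slope_ge0.
      by rewrite addr_ge0 ?mulr_ge0 ?divr_ge0 ?exprn_ge0.
    by rewrite lerD// ler_pM2l.
  have -> : 16 * (n%:R * sg) * (2 * (a + bb) + 2 / n%:R) =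
     32 * (n%:R * sg) * (a + bb) + 32 * sg by field; rewrite gt_eqF.
  lra.
have main : n%:R * (V + eps * sym_entropy w) <=
   2 * (32 * M * m%:R + 240 * (u * lN + n%:R * sg * r) +
     (32 * (n%:R * sg) * (a + bb) + 64 * lN) + t + 12).
  have e1 : n%:R * (2 * (n%:R^-1 * SF - PF)) = 2 * (SF - n%:R * PF).
    by field; rewrite gt_eqF.
  have e2 : 32 * (64 * M)^-1 * n%:R * PF2 <= n%:R * V / 2.
    apply: (@le_trans _ _ (32 * (64 * M)^-1 * n%:R * (M * V))).
      by rewrite ler_pM2l// !mulr_gt0.
    rewrite le_eqVlt; apply/orP; left; apply/eqP; field; by rewrite gt_eqF.
  have := ler_wpM2l (ltW nR0) basic; rewrite e1; lra.
have abb0 : 0 <= a + bb by rewrite (le_trans D0).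
rewrite -(ler_pM2l nR0); apply: le_trans main _.
have -> : n%:R * (oracle_const gamma * (M ^+ 2 * ((m%:R + A * lN) / n%:R) + u * (lN / n%:R) +
      r * tau + tau * (a + bb))) =
   oracle_const gamma * (M ^+ 2 * (m%:R + A * lN) + u * lN +
      r * (n%:R * tau) + (n%:R * tau) * (a + bb)) by field; rewrite gt_eqF.
have nsg : n%:R * sg <= n%:R * tau by rewrite ler_pM2l.
have t1 : n%:R * sg * r <= n%:R * tau * r by rewrite ler_wpM2r.
have t2 : n%:R * sg * (a + bb) <= n%:R * tau * (a + bb) by rewrite ler_wpM2r.
have MM : M <= M ^+ 2 by rewrite expr2 ler_peMl// ltW.
have Al : lN <= A * lN by rewrite ler_peMl// ltW.
have A0 : 0 < A by exact: lt_le_trans A1.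
have Al0 : 0 < A * lN by rewrite mulr_gt0.
have MAl : A * lN <= M * (A * lN) by rewrite ler_peMl// ltW.
have tG : t <= 64 * (1 + G) * (M ^+ 2 * (A * lN)).
  apply: (@le_trans _ _ (64 * (1 + G) * (M * (A * lN)))).
    rewrite /t; have : M * (G * lN) <= M * (G * (A * lN)).
      by rewrite !ler_pM2l//; lra.
    lra.
  rewrite ler_pM2l; last by lra.
  by rewrite ler_pM2r.
have MmM : M * m%:R <= M ^+ 2 * m%:R by rewrite ler_wpM2r.
have M2Al : M * (A * lN) <= M ^+ 2 * (A * lN) by rewrite ler_pM2r.
(* The coefficients to dominate are 64 for the dimension and for the masses outside [J],
   [304 + 128 G] for [A ln N], and 480 for the terms in [u] and [r]. *)
rewrite /oracle_const -/G.
set x1 := M ^+ 2 * m%:R in MmM *; set x2 := M ^+ 2 * (A * lN) in tG M2Al *.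
have x10 : 0 <= x1 by rewrite mulr_ge0 ?sqr_ge0.
have x3 : 0 <= u * lN by rewrite mulr_ge0 ?(ltW lN0)// (le_trans ler01).
have x4 : 0 <= n%:R * tau * r by rewrite !mulr_ge0 ?sqrtr_ge0.
have x5 : 0 <= n%:R * tau * (a + bb) by rewrite !mulr_ge0 ?sqrtr_ge0.
have -> : M ^+ 2 * (m%:R + A * lN) = x1 + x2 by rewrite /x1 /x2; ring.
have x20 : 0 < x2 by rewrite mulr_gt0 ?exprn_gt0.
have G0 : 0 <= G by rewrite (le_trans _ G2).
have Gx1 : 0 <= G * x1 by exact: mulr_ge0.
have Gx3 : 0 <= G * (u * lN) by exact: mulr_ge0.
have Gx4 : 0 <= G * (n%:R * tau * r) by exact: mulr_ge0.
have Gx5 : 0 <= G * (n%:R * tau * (a + bb)) by exact: mulr_ge0.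
have Gx2 : 0 <= G * x2 by rewrite mulr_ge0// ltW.
lra.
Qed.

End Oracle.

Lemma sym_entropy_term_ge0 (R : realType) (x y : R) : 0 < x -> 0 < y ->
  0 <= (x - y) * (ln x - ln y).
Proof.
move=> x0 y0; have [xy|/ltW xy] := leP x y.
  by rewrite mulr_le0// ?subr_le0 ?ler_ln ?posrE.
by rewrite mulr_ge0// subr_ge0 ?ler_ln ?posrE.
Qed.

(** If [x > 2 y], then [x - y >= x / 2] and [ln x - ln y >= ln 2 >= 1/2], so the product is at least
    [x / 4]. *)
Lemma le_sym_entropy_term (R : realType) (x y : R) : 0 < x -> 0 < y ->
  x <= 2 * y + 4 * ((x - y) * (ln x - ln y)).
Proof.
move=> x0 y0; have l0 := sym_entropy_term_ge0 x0 y0.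
have [xy|xy] := leP x (2 * y); first lra.
have : ln 2 <= ln x - ln y.
  by rewrite -ln_div ?posrE// ler_ln ?posrE ?divr_gt0// ler_pdivlMr// ltW.
have := ln2_ge_half R; nra.
Qed.

Lemma sum_le_sym_entropy (R : realType) N (J : {set 'I_N}) (v w : 'rV[R]_N) :
  (forall j, 0 < v 0 j) -> (forall j, 0 < w 0 j) ->
  \sum_(j in J) v 0 j <= 2 * \sum_(j in J) w 0 j +
    4 * \sum_j (v 0 j - w 0 j) * (ln (v 0 j) - ln (w 0 j)).
Proof.
move=> v0 w0.
apply: (@le_trans _ _ (2 * \sum_(j in J) w 0 j +
    4 * \sum_(j in J) (v 0 j - w 0 j) * (ln (v 0 j) - ln (w 0 j)))).
  rewrite !mulr_sumr -big_split; apply: ler_sum => j _; exact: le_sym_entropy_term.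
rewrite lerD2l ler_pM2l// [leRHS](bigID (fun j => j \in J)) /= lerDl.
by apply: sumr_ge0 => j _; exact: sym_entropy_term_ge0.
Qed.

(** * Nonnegativity of the extended-real quantities in the bounds *)

Section Degenerate.
Context (R : realType) (dS : measure_display) (S : measurableType dS).
Variables (P : probability S R) (L : set (S -> R)).

Lemma L2_dim_ge0 : (0 <= L2_dim P L)%E.
Proof.
apply: ereal_sup_ubound; exists 0%N => //; exists (fun=> fun=> 0); split=> [[]//|a _ []//].
Qed.

Lemma L2_U_ge0 : (0 <= L2_U P L)%E.
Proof. by rewrite /L2_U adde_ge0// le_max lexx. Qed.

Lemma max_proj_orth_norm_ge0 N (h : 'I_N -> S -> R) (J : {set 'I_N}) :
  (0 <= \big[maxe/0]_(j in J) proj_orth_norm P L (h j))%E.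
Proof.
by elim/big_ind: _ => // [x y x0 y0|j _]; [rewrite le_max x0|exact: Lnorm_ge0].
Qed.

End Degenerate.

(** [D] and [C] are fixed once [gamma] is. A measurable event is exhibited on which the bounds hold,
    since the set where they hold depends on an arbitrary selection [lhat] of minimum points. *)
Theorem theorem6 (R : realType) (gamma : R) (hgamma : 0 < gamma) :
  exists D C : R, 0 < D /\ 0 < C /\
  forall (dS dO : measure_display) (S : measurableType dS)
    (Omega : measurableType dO) (Pr : probability Omega R)
    (P : probability S R) (mu : {sigma_finite_measure set S -> \bar R})
    (n N : nat) (X : 'I_n -> {RV Pr >-> S})
    (fstar : S -> R) (M : R) (h : 'I_N -> S -> R)
    (eps A : R) (lhat : Omega -> 'rV[R]_N) (l : 'rV[R]_N)
    (J : {set 'I_N}) (L : set (S -> R)),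
  (0 < n)%N ->
  ln n%:R `^ gamma <= N%:R ->
  iid_sample P X ->
  has_density mu P fstar ->
  1 <= M ->
  (forall x, fstar x <= M) ->
  (forall j, probability_density mu (h j)) ->
  (forall j x, h j x <= 1) ->
  1 <= A ->
  D * Num.sqrt (A * ln N%:R / n%:R) <= eps ->
  (forall w, is_argmin (@simplex R N)
     (penalized_risk mu h eps (empirical_mean (fun i => X i w))) (lhat w)) ->
  is_argmin (@simplex R N)
     (penalized_risk mu h eps (fun g => \int[P]_x g x)) l ->
  L2_subspace P L ->
  let d := L2_dim P L in
  let U := L2_U P L in
  let rho := (\big[maxe/0]_(j in J) proj_orth_norm P L (h j))%E in
  let rem := ((M ^+ 2)%:E * ((d + (A * ln N%:R)%:E) * ((n%:R * eps)^-1)%:E)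
              + rho + U * (ln N%:R / (n%:R * eps))%:E)%E in
  exists E : set Omega,
    measurable E /\ ((1 - N%:R `^ (- A))%:E <= Pr E)%E /\
    forall w, E w ->
      [/\ ((\sum_(j in ~: J) lhat w 0%R j)%R%:E <=
             C%:E * ((\sum_(j in ~: J) l 0%R j)%R%:E + rem))%E,
          ((\sum_(j in ~: J) l 0%R j)%R%:E <=
             C%:E * ((\sum_(j in ~: J) lhat w 0%R j)%R%:E + rem))%E &
          ('N[mu]_2%:E[EFin \o (mixture h (lhat w) \- mixture h l)%R] ^+ 2
             + eps%:E * symKL (lhat w) l <=
           C%:E *
             maxe ((M ^+ 2)%:E * ((d + (A * ln N%:R)%:E) * (n%:R^-1)%:E))
            (maxe ((\sum_(j in ~: J) l 0%R j) *
                     Num.sqrt (A * ln N%:R / n%:R))%R%:E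
            (maxe (rho * (Num.sqrt (A * ln N%:R / n%:R))%:E)
                  (U * (ln N%:R / n%:R)%:E))))%E].
Proof.
pose C1 := oracle_const gamma.
have C1ge : 1 <= C1 := oracle_const_ge1 hgamma.
have C1gt : 0 < 16 * C1 by rewrite mulr_gt0// (lt_le_trans ltr01 C1ge).
(* [absorption] asks for [16 C1 tau <= eps] and returns [16 C1] in the first two bounds; in the
   third it returns [4 C1], and a sum of four terms is at most four times their maximum. *)
exists (16 * C1), (16 * C1); split=> //; split=> //.
move=> dS dO S Omega Pr P mu n N X fstar M h eps A lhat l J L n0 hN iidX hP M1 fM dh h1
  A1 heps hlhat hl hL d U rho rem.
(* For [N = 1] the required probability [1 - N^(-A)] is zero and the empty event will do; [N = 0] is
   excluded because the simplex is then empty. *)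
have [N1|N2] := leqP N 1.
  exists set0; split=> //; split; last by [].
  rewrite measure0 lee_fin; case: N h lhat l J hN dh h1 heps hlhat hl rho rem N1
    => [|[|//]] h lhat l J hN dh h1 heps hlhat hl rho rem _.
    by have [[_]] := hl; rewrite big_ord0 => /esym/eqP; rewrite oner_eq0.
  by rewrite powR1 subrr.
have nR0 : 0 < n%:R :> R by rewrite ltr0n.
have lN0 : 0 < ln N%:R :> R by rewrite ln_gt0// ltr1n.
have A0 : 0 < A by exact: lt_le_trans A1.
have M0 : 0 < M by exact: lt_le_trans M1.
have tau0 : 0 < Num.sqrt (A * ln N%:R / n%:R) by rewrite sqrtr_gt0 divr_gt0 ?mulr_gt0.
have eps0 : 0 < eps by apply: lt_le_trans heps; rewrite mulr_gt0.
have y0 : 0 < (n%:R * eps)^-1 by rewrite invr_gt0 mulr_gt0.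
have dge : (0 <= d)%E by exact: L2_dim_ge0.
have Uge : (0 <= U)%E by exact: L2_U_ge0.
have rhoge : (0 <= rho)%E by exact: max_proj_orth_norm_ge0.
have M2 : 0 < M ^+ 2 by rewrite exprn_gt0.
have z0 : 0 < ln N%:R / (n%:R * eps) by rewrite divr_gt0 ?mulr_gt0.
have z1 : 0 < ln N%:R / n%:R :> R by rewrite divr_gt0.
(* An infinite dimension or an infinite [U(L)] makes the right-hand sides [+oo], and the whole space
   serves as event. *)
have [infinite|] := boolP ((d == +oo) || (U == +oo))%E.
  have T1ge : (0 <= (M ^+ 2)%:E * ((d + (A * ln N%:R)%:E) * ((n%:R * eps)^-1)%:E))%E.
    by rewrite !mule_ge0 ?adde_ge0// lee_fin ltW// mulr_gt0.
  have remE : rem = +oo%E.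
    move: infinite; rewrite /rem => /orP[/eqP dE|/eqP UE].
      rewrite dE addye// gt0_mulye ?lte_fin// gt0_muley ?lte_fin// addye; last first.
        by rewrite gt_eqF// (lt_le_trans ltNy0 rhoge).
      by rewrite addye// gt_eqF// (lt_le_trans ltNy0)// mule_ge0// lee_fin ltW.
    rewrite UE gt0_mulye ?lte_fin// addey// gt_eqF// (lt_le_trans ltNy0)//.
    exact: adde_ge0.
  exists setT; split=> //; split.
    by rewrite probability_setT lee_fin lerBlDr lerDl powR_ge0.
  move=> w _; split.
  - by rewrite remE addey// gt0_muley ?lte_fin// leey.
  - by rewrite remE addey// gt0_muley ?lte_fin// leey.
  - set mx := maxe _ _; suff -> : mx = +oo%E by rewrite gt0_muley ?lte_fin// leey.
    move: infinite; rewrite /mx => /orP[/eqP dE|/eqP UE].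
      by rewrite dE addye// gt0_mulye ?lte_fin ?invr_gt0// gt0_muley ?lte_fin// maxye.
    by rewrite UE gt0_mulye ?lte_fin// !maxey.
rewrite negb_or -!ltey => /andP[dfin Ufin] {dge Uge rhoge}.
case: N h lhat l J hN dh h1 heps hlhat hl @rho @rem N2 lN0 tau0 z0 z1
  => [//|N] h lhat l J hN dh h1 heps hlhat hl rho rem N2 lN0 tau0 z0 z1.
have mh j : measurable_fun setT (h j) by case: (dh j).
have h01 j x : 0 <= h j x <= 1 by rewrite h1 andbT; case: (dh j).
have [m [e [b [u [dE [UE u1] mq qu rhoE]]]]] := subspace_residuals hL dfin Ufin mh h01.
set q := fun j x => h j x - \sum_k b j k * e k x in mq qu rhoE.
pose r := \big[Num.max/0]_(j in J) Num.sqrt (rdot P (q j) (q j)).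
have rE : rho = r%:E.
  rewrite /rho /r (big_morph EFin (@EFin_max R) (erefl 0%:E)).
  by apply: eq_bigr => j _; rewrite rhoE.
have r0 : 0 <= r by exact: bigmax_ge_id.
have qr j : j \in J -> rdot P (q j) (q j) <= r ^+ 2.
  move=> jJ; rewrite -[leLHS](sqr_sqrtr (rdot_ge0 P (q j))) lerXn2r ?nnegrE ?sqrtr_ge0//.
  exact: (le_bigmax_cond _ (fun j => Num.sqrt (rdot P (q j) (q j)))).
have [E [mE PE hE]] := oracle_event hgamma n0 N2 hN iidX hP M1 fM dh h1 A1 eps0 hlhat hl
  mq qu u1 r0 qr.
exists E; split=> //; split=> // w Ew; have := hE w Ew; rewrite -/C1.
have lhat0 j : 0 < lhat w 0 j by exact: (estimator_gt0 dh h1 eps0 hlhat).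
have l0 j : 0 < l 0 j by exact: (oracle_gt0 dh h1 eps0 hl).
set V := mixdot _ _ _ _; set K := sym_entropy _ _ _.
set tau := Num.sqrt _ in heps tau0 *.
set a := \sum_(j in ~: J) lhat w 0 j; set b' := \sum_(j in ~: J) l 0 j => key.
have V0 : 0 <= V by exact: rdot_ge0.
have a0 : 0 <= a by apply: sumr_ge0 => j _; exact: ltW.
have b0 : 0 <= b' by apply: sumr_ge0 => j _; exact: ltW.
have ha : a <= 2 * b' + 4 * K by exact: sum_le_sym_entropy.
have hb : b' <= 2 * a + 4 * K.
  rewrite (_ : K = \sum_j (l 0 j - lhat w 0 j) * (ln (l 0 j) - ln (lhat w 0 j))).
    exact: sum_le_sym_entropy.
  by apply: eq_bigr => j _; ring.
set l' := ln N.+1%:R in lN0 z0 z1 key *.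
have [] := @absorption R C1 eps tau r a b' K V
  (M ^+ 2 * ((m%:R + A * l') / n%:R) + u * (l' / n%:R)) C1ge eps0 (ltW tau0) heps r0 a0 b0 V0 _ key ha hb.
- rewrite addr_ge0// mulr_ge0 ?(ltW z1) ?(ltW M2) ?(le_trans ler01 u1)//.
  by rewrite divr_ge0 ?(ltW nR0)// addr_ge0// mulr_ge0 ?(ltW A0) ?(ltW lN0).
have -> : (M ^+ 2 * ((m%:R + A * l') / n%:R) + u * (l' / n%:R)) / eps =
  M ^+ 2 * ((m%:R + A * l') * (n%:R * eps)^-1) + u * (l' / (n%:R * eps)).
  by field; rewrite !gt_eqF.
move=> i1 i2 i3.
have remE : rem = (M ^+ 2 * ((m%:R + A * l') * (n%:R * eps)^-1) + r +
   u * (l' / (n%:R * eps)))%:E.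
  by rewrite /rem rE /d dE /U UE.
split.
- rewrite remE -EFinD -EFinM lee_fin; apply: le_trans i1 _.
  rewrite le_eqVlt; apply/orP; left; apply/eqP; ring.
- rewrite remE -EFinD -EFinM lee_fin; apply: le_trans i2 _.
  rewrite le_eqVlt; apply/orP; left; apply/eqP; ring.
rewrite (_ : mixture h (lhat w) \- mixture h l = mixture h (lhat w - l)); last first.
  by apply/funext => x; rewrite mixtureB.
rewrite (Lnorm2E (mixture_Lfun2 dh h1 _)) -EFin_expe sqr_sqrtr ?rdot_ge0//.
rewrite symKLE// -EFinM -EFinD -/V -/K rE /d dE /U UE.
rewrite -?(EFinD, EFinM, EFin_max) lee_fin; apply: le_trans i3 _.
set c1 := M ^+ 2 * _; set c2 := b' * tau; set c3 := r * tau; set c4 := u * _.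
set mx := Num.max _ _.
have m1 : c1 <= mx by rewrite le_max lexx.
have m2 : c2 <= mx by rewrite !le_max lexx orbT.
have m3 : c3 <= mx by rewrite !le_max lexx !orbT.
have m4 : c4 <= mx by rewrite !le_max lexx !orbT.
have -> : tau * b' = c2 by rewrite /c2 mulrC.
have : C1 * (c1 + c4 + c3 + c2) <= C1 * (4 * mx).
  by rewrite ler_pM2l; [lra|exact: lt_le_trans C1ge].
lra.
Qed.
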